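(* For each $\delta\in\{{\tt Borda}_{\uparrow},{\tt Borda}_{\downarrow},{\tt Borda}_{av}\}$, the problem $t$-CCDV-$\delta$ is fixed-parameter tractable with respect to the combined parameter consisting of the number $\ell$ of allowed vote deletions and the maximum number $t$ of ranked candidates in a vote.
   Context: Let $C$ be a set of $m$ candidates. A top-truncated vote $v$ over $C$ is a linear order of some subset $C_v\subseteq C$; its length is $|v|=|C_v|$, the candidates of $C_v$ are ranked and those of $C\setminus C_v$ are unranked. A multiset of votes is $t$-truncated if every vote has length at most $t$. For a ranked candidate $c$, ${\tt pos}(v,c)\in\{1,\dots,|v|\}$ is its position. Scoring variants: ${\tt Borda}_{\uparrow}$: the candidate at position $i$ receives $m-i$ points, unranked candidates receive $0$; ${\tt Borda}_{\downarrow}$: the candidate at position $i$ receives $|v|-i+1$ points, unranked candidates receive $0$; ${\tt Borda}_{av}$: the candidate at position $i$ receives $m-i$ points, each unranked candidate receives $\frac{m-|v|-1}{2}$ points. A candidate's score is the sum of its points over all votes; $c$ is the unique winner if its score is strictly larger than that of every other candidate. $t$-CCDV-$\delta$: Input: a set $C$ of candidates, $p\in C$, a multiset $V$ of $t$-truncated votes over $C$, and an integer $\ell\ge0$. Question: is there $V''\subseteq V$ with $|V''|\le\ell$ such that $p$ is the unique $\delta$-winner of $(C,V\setminus V'')$? *)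

(* Defs.v *)
From mathcomp Require Import all_boot all_order all_algebra.
Set Implicit Arguments. Unset Strict Implicit. Unset Printing Implicit Defensive.
Import Order.TTheory GRing.Theory Num.Theory.

(* Machine model: a unit-cost RAM with addition, truncated subtraction,*)
(* indirect addressing and conditional jumps (polynomially equivalent  *)
(* to Turing machines).                                                *)

Inductive instr : Type :=
| IConst of nat & nat          (* IConst r n   : R[r] := n                *)
| IAdd   of nat & nat & nat    (* IAdd r a b   : R[r] := R[a] + R[b]      *)
| ISub   of nat & nat & nat    (* ISub r a b   : R[r] := R[a] - R[b] (trunc.) *)
| ILoad  of nat & nat          (* ILoad r a    : R[r] := R[R[a]]          *)
| IStore of nat & nat          (* IStore a r   : R[R[a]] := R[r]          *)
| IJz    of nat & nat          (* IJz r l      : if R[r] = 0 goto l       *)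
| IJmp   of nat                (* IJmp l       : goto l                   *)
| IHalt.                       (* halt; the output is R[0]                *)

Definition program := seq instr.

Record config := Config { pc : nat; regs : nat -> nat }.

Definition upd (R : nat -> nat) (r v : nat) : nat -> nat :=
  fun i => if i == r then v else R i.

(* one step; a halted configuration (current instruction IHalt, or pc out
   of range) is left unchanged *)
Definition step (P : program) (c : config) : config :=
  let R := regs c in
  match nth IHalt P (pc c) with
  | IConst r n => Config (pc c).+1 (upd R r n)
  | IAdd r a b => Config (pc c).+1 (upd R r (R a + R b))
  | ISub r a b => Config (pc c).+1 (upd R r (R a - R b))
  | ILoad r a  => Config (pc c).+1 (upd R r (R (R a)))
  | IStore a r => Config (pc c).+1 (upd R (R a) (R r))
  | IJz r l    => if R r == 0 then Config l R else Config (pc c).+1 R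
  | IJmp l     => Config l R
  | IHalt      => c
  end.

Definition halted (P : program) (c : config) : bool :=
  if nth IHalt P (pc c) is IHalt then true else false.

Definition run (P : program) (c : config) (k : nat) : config := iter k (step P) c.

Definition init (x : seq nat) : config :=
  Config 0 (fun i => if i is j.+1 then nth 0 x j else size x).

Definition outputs_within (P : program) (x : seq nat) (k y : nat) : Prop :=
  halted P (run P (init x) k) /\ regs (run P (init x) k) 0 = y.

Definition computable2 (f : nat -> nat -> nat) : Prop :=
  exists P : program, forall a b, exists k, outputs_within P [:: a; b] k (f a b).

(* size of an input: number of entries plus their unary sizes *)
Definition input_size (x : seq nat) : nat := size x + sumn x.

(* Candidates C = 'I_m; a vote is a duplicate-free sequence of        *)
(* candidates (the ranked ones, from position 1 onward).              *)

Inductive borda_rule := BordaUp | BordaDown | BordaAv.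

Local Open Scope ring_scope.

(* position pos(v,c) = index c v + 1 for a ranked candidate *)
Definition points (d : borda_rule) (m : nat) (v : seq 'I_m) (c : 'I_m) : rat :=
  if c \in v then
    match d with
    | BordaUp   => m%:R - (index c v).+1%:R
    | BordaDown => (size v)%:R - (index c v).+1%:R + 1
    | BordaAv   => m%:R - (index c v).+1%:R
    end
  else
    match d with
    | BordaUp | BordaDown => 0
    | BordaAv => (m%:R - (size v)%:R - 1) / 2
    end.

Definition score (d : borda_rule) (m : nat) (V : seq (seq 'I_m)) (c : 'I_m) : rat :=
  \sum_(v <- V) points d v c.

Definition unique_winner (d : borda_rule) (m : nat) (V : seq (seq 'I_m)) (p : 'I_m) : Prop :=
  forall c : 'I_m, c != p -> score d V c < score d V p.

(* yes-instances of CCDV-d: delete a sub-multiset V'' of V, |V''| <= l *)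
Definition ccdv (d : borda_rule) (m : nat) (p : 'I_m) (V : seq (seq 'I_m)) (l : nat) : Prop :=
  exists V'' V' : seq (seq 'I_m),
    perm_eq V (V'' ++ V') /\ (size V'' <= l)%N /\ unique_winner d V' p.

Local Close Scope ring_scope.

Definition encode (t m : nat) (p : 'I_m) (l : nat) (V : seq (seq 'I_m)) : seq nat :=
  [:: t; m; val p; l; size V] ++ flatten [seq size v :: map val v | v <- V].

Definition fpt_ccdv (d : borda_rule) : Prop :=
  exists (P : program) (f : nat -> nat -> nat) (c : nat),
    computable2 f /\
    forall (t m : nat) (p : 'I_m) (l : nat) (V : seq (seq 'I_m)),
      all uniq V -> all (fun v => size v <= t) V ->
      let x := encode t p l V in
      let T := f l t * input_size x ^ c in
      (ccdv d p V l -> outputs_within P x T 1) /\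
      (~ ccdv d p V l -> outputs_within P x T 0).

(* Main.v *)
Require Import Defs.
From mathcomp Require Import all_boot all_order all_algebra.
From mathcomp Require Import zify ring lra.
Set Implicit Arguments. Unset Strict Implicit. Unset Printing Implicit Defensive.

(** Subtracting from each vote the points of its unranked candidates turns all
    three rules into one in which ranked candidates get natural weights and
    unranked ones get 0, so deleting a vote never raises a score. Guess the final
    score [th] of [p], and call a candidate bad if its full score is at least
    [th]. Every bad candidate other than [p] is ranked in a deleted vote, so at
    most [l t + 1] candidates are bad. Votes that agree after all good candidates
    are identified have the same effect on the bad ones, and good candidates lose
    to [p] whatever is deleted; hence it suffices to consider the first [l] votes
    of each similarity class, at most [l (l t + 3)^t] votes in all, and every
    subset of these is tried. The subsets are enumerated by a binary counter run
    for [tower l t] steps, and each is tested against the actual scores, so no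
    check that few candidates are bad is needed for soundness.

    The algorithm is written in a small loop language whose loop bounds are
    variables that the loop does not change: the running time is then at most a
    constant times the product of (bound + 1) over all loops, read off the
    syntax. *)

(** * A loop language and its compilation to the RAM *)

Inductive expr : Type :=
| Cst of nat
| Var of nat
| Add of expr & expr
| Sub of expr & expr
| Get of nat & expr.

Inductive cmd : Type :=
| Skip
| Asn of nat & expr
| Put of nat & expr & expr
| Seq of cmd & cmd
| If of expr & cmd & cmd
| For of nat & nat & cmd.

Record state := State { var : nat -> nat; arr : nat -> nat -> nat }.

Definition setv (s : state) (x v : nat) : state :=
  State (fun y => if y == x then v else var s y) (arr s).

Definition seta (s : state) (a i v : nat) : state :=
  State (var s)
    (fun b => if b == a then fun j => if j == i then v else arr s a j else arr s b).

Fixpoint ev (e : expr) (s : state) : nat :=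
  match e with
  | Cst n => n
  | Var x => var s x
  | Add e1 e2 => ev e1 s + ev e2 s
  | Sub e1 e2 => ev e1 s - ev e2 s
  | Get a e1 => arr s a (ev e1 s)
  end.

(** The bound of a [For] is read once, on entry, and the loop variable is left equal to it, as in
    the compiled loop, which exits once the two agree. *)
Fixpoint ex (c : cmd) (s : state) : state :=
  match c with
  | Skip => s
  | Asn x e => setv s x (ev e s)
  | Put a e1 e2 => seta s a (ev e1 s) (ev e2 s)
  | Seq c1 c2 => ex c2 (ex c1 s)
  | If e c1 c2 => if ev e s == 0 then ex c2 s else ex c1 s
  | For x y c1 =>
      setv (iteri (var s y) (fun k s1 => ex c1 (setv s1 x k)) s) x (var s y)
  end.

Fixpoint mods (c : cmd) : seq nat :=
  match c with
  | Asn x _ => [:: x]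
  | Seq c1 c2 | If _ c1 c2 => mods c1 ++ mods c2
  | For x _ c1 => x :: mods c1
  | _ => [::]
  end.

Fixpoint amods (c : cmd) : seq nat :=
  match c with
  | Put a _ _ => [:: a]
  | Seq c1 c2 | If _ c1 c2 => amods c1 ++ amods c2
  | For _ _ c1 => amods c1
  | _ => [::]
  end.

(** Repetitions are kept: every loop, nested or not, contributes one factor to the time bound. *)
Fixpoint loop_vars (c : cmd) : seq nat :=
  match c with
  | Seq c1 c2 | If _ c1 c2 => loop_vars c1 ++ loop_vars c2
  | For _ y c1 => y :: loop_vars c1
  | _ => [::]
  end.

Lemma iteri_ind (T : Type) (I : nat -> T -> Prop) n (f : nat -> T -> T) x :
  I 0 x -> (forall k y, k < n -> I k y -> I k.+1 (f k y)) -> I n (iteri n f x).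
Proof.
move=> I0; elim: n => [|n IH] //= Hs.
by apply: (Hs) => //; apply: IH => k y kn; apply: (Hs); apply: ltnW.
Qed.

Lemma ex_var c s x : x \notin mods c -> var (ex c s) x = var s x.
Proof.
elim: c s => //= [y e|c1 H1 c2 H2|e c1 H1 c2 H2|y z c1 H1] s.
- by rewrite inE => /negbTE->.
- by rewrite mem_cat negb_or => /andP[/H1 E1 /H2 E2]; rewrite E2 E1.
- by rewrite mem_cat negb_or => /andP[/H1 E1 /H2 E2]; case: ifP.
rewrite inE negb_or => /andP[/negbTE xy /H1 E1]; rewrite xy.
apply: (iteri_ind (I := fun _ s' => var s' x = var s x)) => // k s' _ IH.
by rewrite E1 /= xy.
Qed.

Lemma ex_arr c s a : a \notin amods c -> arr (ex c s) a = arr s a.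
Proof.
elim: c s => //= [b e1 e2|c1 H1 c2 H2|e c1 H1 c2 H2|y z c1 H1] s.
- by rewrite inE => /negbTE->.
- by rewrite mem_cat negb_or => /andP[/H1 E1 /H2 E2]; rewrite E2 E1.
- by rewrite mem_cat negb_or => /andP[/H1 E1 /H2 E2]; case: ifP.
move=> /H1 E1.
apply: (iteri_ind (I := fun _ s' => arr s' a = arr s a)) => // k s' _ IH.
by rewrite E1.
Qed.

(* Register layout of compiled code: register 3 holds the base address [A] of
   the array area, variable [x < 50] lives in register [10 + x], the expression
   stack in registers [60 .. 119], and entry [i] of array [a < 8] at address
   [A + 8 i + a]. *)
Definition vreg x := 10 + x.
Definition sreg d := 60 + d.

(** Three doublings multiply by 8, since the machine has no product. *)
Definition addr_code (a d : nat) : seq instr :=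
  let r := sreg d in
  [:: IAdd r r r; IAdd r r r; IAdd r r r; IAdd r r 3; IConst (sreg d.+1) a;
      IAdd r r (sreg d.+1)].

(** The value ends in stack register [d], and the stack registers below [d] are preserved, so
    pending operands survive. *)
Fixpoint cexpr (d : nat) (e : expr) : seq instr :=
  match e with
  | Cst n => [:: IConst (sreg d) n]
  | Var x => [:: IConst (sreg d) 0; IAdd (sreg d) (sreg d) (vreg x)]
  | Add e1 e2 =>
      cexpr d e1 ++ cexpr d.+1 e2 ++ [:: IAdd (sreg d) (sreg d) (sreg d.+1)]
  | Sub e1 e2 =>
      cexpr d e1 ++ cexpr d.+1 e2 ++ [:: ISub (sreg d) (sreg d) (sreg d.+1)]
  | Get a e1 => cexpr d e1 ++ addr_code a d ++ [:: ILoad (sreg d) (sreg d)]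
  end.

Fixpoint wfe (d : nat) (e : expr) : bool :=
  match e with
  | Cst n => d < 60
  | Var x => (d < 60) && (x < 50)
  | Add e1 e2 | Sub e1 e2 => wfe d e1 && wfe d.+1 e2
  | Get a e1 => [&& wfe d e1, a < 8 & d.+1 < 60]
  end.

(** Jump targets are absolute, hence the parameter [off], the address at which the code is
    placed. *)
Fixpoint compile (off : nat) (c : cmd) : seq instr :=
  match c with
  | Skip => [::]
  | Asn x e => cexpr 0 e ++ [:: IConst (sreg 1) 0; IAdd (vreg x) (sreg 0) (sreg 1)]
  | Put a e1 e2 =>
      cexpr 0 e1 ++ addr_code a 0 ++ cexpr 1 e2 ++ [:: IStore (sreg 0) (sreg 1)]
  | Seq c1 c2 =>
      let code1 := compile off c1 in code1 ++ compile (off + size code1) c2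
  | If e c1 c2 =>
      let ce := cexpr 0 e in
      let o1 := off + size ce + 1 in
      let code1 := compile o1 c1 in
      let o2 := o1 + size code1 + 1 in
      let code2 := compile o2 c2 in
      ce ++ IJz (sreg 0) o2 :: code1 ++ IJmp (o2 + size code2) :: code2
  | For x y c1 =>
      let body := compile (off + 3) c1 in
      [:: IConst (vreg x) 0; ISub (sreg 0) (vreg y) (vreg x);
          IJz (sreg 0) (off + 3 + size body + 3)] ++ body ++
      [:: IConst (sreg 0) 1; IAdd (vreg x) (vreg x) (sreg 0); IJmp (off + 1)]
  end.

Fixpoint wf (c : cmd) : bool :=
  match c with
  | Skip => true
  | Asn x e => (x < 50) && wfe 0 e
  | Put a e1 e2 => [&& a < 8, wfe 0 e1 & wfe 1 e2]
  | Seq c1 c2 => wf c1 && wf c2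
  | If e c1 c2 => [&& wfe 0 e, wf c1 & wf c2]
  | For x y c1 => [&& x < 50, y < 50, x \notin mods c1 & wf c1]
  end.

(** Loop bounds must be untouched by all of [c], not only by their own loop: the time bound can then
    be evaluated in the initial state. *)
Definition stable (c : cmd) : bool := all (fun y => y \notin mods c) (loop_vars c).

(** Both branches of an [If] are counted; the 8 of a loop covers its 3 fixed instructions and 5 per
    round. *)
Fixpoint weight (c : cmd) : nat :=
  match c with
  | Skip => 0
  | Asn x e => size (cexpr 0 e) + 2
  | Put a e1 e2 => size (cexpr 0 e1) + 6 + size (cexpr 1 e2) + 1
  | Seq c1 c2 => weight c1 + weight c2
  | If e c1 c2 => size (cexpr 0 e) + 2 + weight c1 + weight c2
  | For x y c1 => weight c1 + 8
  end.

Definition time_bound (c : cmd) (sigma : nat -> nat) : nat :=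
  weight c * \prod_(y <- loop_vars c) (sigma y).+1.

Definition code_at (P : program) (off : nat) (code : seq instr) : Prop :=
  forall i, i < size code -> nth IHalt P (off + i) = nth IHalt code i.

Lemma code_at_cat P off c1 c2 :
  code_at P off (c1 ++ c2) -> code_at P off c1 /\ code_at P (off + size c1) c2.
Proof.
move=> H; split=> i Hi.
- by rewrite H ?size_cat ?nth_cat ?Hi //; lia.
rewrite -addnA H ?size_cat ?ltn_add2l // nth_cat ifF; first by congr nth; lia.
by lia.
Qed.

Lemma code_at_cons P off i c :
  code_at P off (i :: c) -> code_at P off [:: i] /\ code_at P (off + 1) c.
Proof. exact: (@code_at_cat P off [:: i] c). Qed.

Definition straight (i : instr) : bool :=
  match i with IJz _ _ | IJmp _ | IHalt => false | _ => true end.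

Definition exec1 (R : nat -> nat) (i : instr) : nat -> nat :=
  match i with
  | IConst r n => upd R r n
  | IAdd r a b => upd R r (R a + R b)
  | ISub r a b => upd R r (R a - R b)
  | ILoad r a => upd R r (R (R a))
  | IStore a r => upd R (R a) (R r)
  | _ => R
  end.

Lemma run_add P c k1 k2 : run P c (k1 + k2) = run P (run P c k1) k2.
Proof. by rewrite /run addnC iterD. Qed.

Lemma run_straight P off code R : code_at P off code -> all straight code ->
  run P (Config off R) (size code) = Config (off + size code) (foldl exec1 R code).
Proof.
elim: code off R => [|i code IH] off R; first by rewrite addn0.
move=> H /andP[si sc]; rewrite (run_add _ _ 1 (size code)).
have H0 := H 0 isT; rewrite addn0 /= in H0.
have -> : run P (Config off R) 1 = Config off.+1 (exec1 R i).
  by rewrite /run /= /step /= H0; case: i si H H0.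
by rewrite IH ?addSnnS // => j Hj; rewrite addSnnS H.
Qed.

Lemma run_one P off i R : code_at P off [:: i] -> straight i ->
  run P (Config off R) 1 = Config (off + 1) (exec1 R i).
Proof.
by move=> C si; rewrite -[1]/(size [:: i]) run_straight //= si.
Qed.

Lemma run_jmp P off l R : code_at P off [:: IJmp l] ->
  run P (Config off R) 1 = Config l R.
Proof. by move=> /(_ 0 isT); rewrite addn0 /run /= /step /= => ->. Qed.

Lemma run_jz P off r l R : code_at P off [:: IJz r l] ->
  run P (Config off R) 1 = Config (if R r == 0 then l else off + 1) R.
Proof.
by move=> /(_ 0 isT); rewrite addn0 addn1 /run /= /step /= => ->; case: ifP.
Qed.

Lemma straight_cexpr d e : all straight (cexpr d e).
Proof.
by elim: e d => //= [e1 H1 e2 H2|e1 H1 e2 H2|a e H] d; rewrite !all_cat ?H1 ?H2 ?H.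
Qed.

(** The condition [128 <= A] puts the arrays beyond the expression stack, which ends at register
    119. *)
Definition represents (A : nat) (s : state) (R : nat -> nat) : Prop :=
  [/\ 128 <= A, R 3 = A, forall x, x < 50 -> R (vreg x) = var s x
    & forall a i, a < 8 -> R (A + 8 * i + a) = arr s a i].

Lemma repr_sreg A s R d v : d < 60 -> represents A s R -> represents A s (upd R (sreg d) v).
Proof.
rewrite /upd /sreg /vreg => Hd [HA H3 Hv Ha]; split => //= [x Hx|a i Hi].
- by rewrite ifF; [exact: Hv|rewrite /vreg; lia].
by rewrite ifF; [exact: Ha|lia].
Qed.

Lemma repr_vreg A s R x v :
  x < 50 -> represents A s R -> represents A (setv s x v) (upd R (vreg x) v).
Proof.
rewrite /upd /vreg => Hx [HA H3 Hv Ha]; split => //= [y Hy|a i Hi].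
- by rewrite /vreg eqn_add2l; case: eqP => // _; exact: Hv.
by rewrite ifF; [exact: Ha|lia].
Qed.

(** Since [a < 8], the address [A + 8 * i + a] determines [i] and [a], so the write disturbs no
    other entry. *)
Lemma repr_seta A s R a i v :
  a < 8 -> represents A s R -> represents A (seta s a i v) (upd R (A + 8 * i + a) v).
Proof.
rewrite /upd /vreg => Hx [HA H3 Hv Ha]; split => //= [|y Hy|b j Hb].
- by rewrite ifF //; lia.
- by rewrite ifF; [exact: Hv|rewrite /vreg; lia].
case: eqP => [Eq|Neq].
  have -> : b = a by lia.
  have -> : j = i by lia.
  by rewrite !eqxx.
rewrite Ha //; case: eqP => // Eba; rewrite -Eba.
by case: eqP => // Eji; case: Neq; rewrite Eba Eji.
Qed.

Lemma updE R r v i : upd R r v i = if i == r then v else R i.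
Proof. by []. Qed.

Lemma addr_codeP a d A s R : a < 8 -> d.+1 < 60 -> represents A s R ->
  let R' := foldl exec1 R (addr_code a d) in
  [/\ represents A s R', forall j, j < d -> R' (sreg j) = R (sreg j)
    & R' (sreg d) = A + 8 * R (sreg d) + a].
Proof.
move=> Ha Hd HR; rewrite /=; split.
- by do !(apply: repr_sreg; first lia).
- by move=> j Hj; rewrite !updE /sreg !ifF //; lia.
have E1 : (sreg d == sreg d.+1) = false by rewrite /sreg; lia.
have E2 : (3 == sreg d) = false by rewrite /sreg; lia.
have E3 : (3 == sreg d.+1) = false by rewrite /sreg; lia.
case: HR => _ H3 _ _.
by rewrite /upd !(eqxx, E1, E2, E3) H3; lia.
Qed.

Lemma wfe_depth d e : wfe d e -> d < 60.
Proof.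
elim: e d => //= [x|e1 H1 e2 _|e1 H1 e2 _|a e1 H1] d.
- by case/andP.
- by case/andP=> /H1.
- by case/andP=> /H1.
by case/and3P=> /H1.
Qed.

Lemma cexprP d e A s R : wfe d e -> represents A s R ->
  let R' := foldl exec1 R (cexpr d e) in
  [/\ represents A s R', forall j, j < d -> R' (sreg j) = R (sreg j)
    & R' (sreg d) = ev e s].
Proof.
have D d' j : j < d' -> (sreg j == sreg d') = false by rewrite /sreg; lia.
elim: e d R => [n|x|e1 H1 e2 H2|e1 H1 e2 H2|a e1 H1] d R /=.
- move=> Hd HR; split; [exact: repr_sreg| |by rewrite updE eqxx].
  by move=> j Hj; rewrite updE D.
- move=> /andP[Hd Hx] HR; split; first by do 2!(apply: repr_sreg => //).
    by move=> j Hj; rewrite !updE !D.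
  have Hn : (vreg x == sreg d) = false by rewrite /vreg /sreg; lia.
  by rewrite !updE !eqxx Hn; case: HR => _ _ -> .
- move=> /andP[W1 W2] HR; rewrite !foldl_cat /=.
  have [R1 P1 V1] := H1 d R W1 HR.
  have [R2 P2 V2] := H2 d.+1 _ W2 R1.
  split; last by rewrite updE eqxx V2 P2 // V1.
    by apply: repr_sreg => //; exact: wfe_depth W1.
  by move=> j Hj; rewrite updE D // P2 ?P1 // ltnW.
- move=> /andP[W1 W2] HR; rewrite !foldl_cat /=.
  have [R1 P1 V1] := H1 d R W1 HR.
  have [R2 P2 V2] := H2 d.+1 _ W2 R1.
  split; last by rewrite updE eqxx V2 P2 // V1.
    by apply: repr_sreg => //; exact: wfe_depth W1.
  by move=> j Hj; rewrite updE D // P2 ?P1 // ltnW.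
move=> /and3P[W1 Wa Wd] HR; rewrite foldl_cat -[X in foldl _ _ X]/(addr_code a d ++ _) foldl_cat.
have [R1 P1 V1] := H1 d R W1 HR.
have [R2 P2 V2] := addr_codeP Wa Wd R1.
move: R2 P2 V2; set R3 := foldl _ _ (addr_code a d) => R2 P2 V2.
rewrite [foldl _ R3 _]/=.
split; [by apply: repr_sreg => //; lia| |].
  by move=> j Hj; rewrite updE D // P2 ?P1.
by rewrite updE eqxx V2 V1; case: R2 => _ _ _ ->.
Qed.

(** * Correctness and running time of compiled code *)

Definition correct (c : cmd) (s : state) (T : nat) : Prop :=
  forall A P off R, code_at P off (compile off c) -> represents A s R ->
  exists k R', [/\ k <= T,
    run P (Config off R) k = Config (off + size (compile off c)) R'
    & represents A (ex c s) R'].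

Lemma correct_seq c1 c2 s T1 T2 :
  correct c1 s T1 -> correct c2 (ex c1 s) T2 -> correct (Seq c1 c2) s (T1 + T2).
Proof.
move=> H1 H2 A P off R /= /code_at_cat[C1 C2] HR.
have [k1 [R1 [K1 E1 HR1]]] := H1 _ _ _ _ C1 HR.
have [k2 [R2 [K2 E2 HR2]]] := H2 _ _ _ _ C2 HR1.
exists (k1 + k2), R2; split => //; first exact: leq_add.
by rewrite run_add E1 E2 size_cat addnA.
Qed.

Lemma correct_leq c s T1 T2 : T1 <= T2 -> correct c s T1 -> correct c s T2.
Proof.
move=> L H A P off R C HR; have [k [R' [K E HR']]] := H _ _ _ _ C HR.
by exists k, R'; split => //; apply: leq_trans L.
Qed.

Lemma prod_loop_gt0 c (sigma : nat -> nat) :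
  0 < \prod_(y <- loop_vars c) (sigma y).+1.
Proof. by rewrite prodn_gt0. Qed.

(** States contain functions, and two descriptions of the same state may agree only pointwise. *)
Lemma repr_ext A s s' R : represents A s R ->
  var s =1 var s' -> (forall a, arr s a =1 arr s' a) -> represents A s' R.
Proof.
case=> HA H3 Hv Ha Ev Ea; split => // [x Hx|a i Hi].
  by rewrite -Ev Hv.
by rewrite -Ea Ha.
Qed.

Lemma correct_if e c1 c2 s T1 T2 : wfe 0 e ->
  (ev e s != 0 -> correct c1 s T1) -> (ev e s = 0 -> correct c2 s T2) ->
  correct (If e c1 c2) s (size (cexpr 0 e) + 2 + T1 + T2).
Proof.
move=> We H1 H2 A P off R /= C HR.
have [Ce /code_at_cons[Cz /code_at_cat[C1 /code_at_cons[Cj C2]]]] := code_at_cat C.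
have [Re _ Ve] := cexprP We HR.
have Er := run_straight R Ce (straight_cexpr 0 e).
move: Re Ve Er; set R' := foldl _ _ _ => Re Ve Er.
have Ez := run_jz R' Cz; rewrite Ve in Ez.
move: C1 Cj C2.
set o1 := off + size (cexpr 0 e) + 1.
set code1 := compile o1 c1.
set o2 := o1 + size code1 + 1.
move=> C1 Cj C2.
have Esz : off + size (cexpr 0 e ++ IJz (sreg 0) o2 :: code1 ++
    IJmp (o2 + size (compile o2 c2)) :: compile o2 c2) = o2 + size (compile o2 c2).
  by rewrite size_cat /= size_cat /= /o2 /o1; lia.
case: eqP => E0.
- have [k [R2 [K E HR2]]] := H2 E0 _ _ _ _ C2 Re.
  exists (size (cexpr 0 e) + (1 + k)), R2; split => //; first by lia.
  by rewrite run_add Er run_add Ez E0 eqxx E Esz.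
- have E0' : ev e s != 0 by exact/eqP.
  have [k [R2 [K E HR2]]] := H1 E0' _ _ _ _ C1 Re.
  exists (size (cexpr 0 e) + (1 + (k + 1))), R2; split => //; first by lia.
  rewrite run_add Er run_add Ez (negbTE E0') run_add E.
  by rewrite (run_jmp _ Cj) Esz.
Qed.

(** A round costs the body plus 5: two instructions for the test and three to increment and jump
    back. The other 3 are the initialisation and the last test. *)
Lemma correct_for x y c s T : x < 50 -> y < 50 -> x \notin mods c ->
  y \notin x :: mods c ->
  (forall k s', (forall z, z \notin x :: mods c -> var s' z = var s z) ->
     correct c (setv s' x k) T) ->
  correct (For x y c) s (3 + var s y * (T + 5)).
Proof.
move=> Hx Hy xc; rewrite inE negb_or => /andP[yx yc] Hc A P off R.
set n := var s y.
set f := fun k s1 => ex c (setv s1 x k).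
rewrite [compile off _]/= => C HR.
have [C0 /code_at_cons[C1 /code_at_cons[C2 /code_at_cat[C3 C4]]]] := code_at_cons C.
have [C5 /code_at_cons[C6 C7]] := code_at_cons C4.
have E2 : off + 1 + 1 = off + 2 by lia.
have E3 : off + 2 + 1 = off + 3 by lia.
rewrite !E2 ?E3 in C2 C3 C4 C5 C6 C7.
set lb := size (compile (off + 3) c) in C2 C4 C5 C6 C7 *.
(* The state at the loop head before round [k], with the loop variable already set. *)
pose sk k := setv (iteri k f s) x k.
have frame k z : z \notin x :: mods c -> var (iteri k f s) z = var s z.
  elim: k => //= k IH Hz; rewrite ex_var; last by move: Hz; rewrite inE negb_or => /andP[].
  by rewrite /= ifF ?IH //; move: Hz; rewrite inE negb_or => /andP[/negbTE].
have loop k : k <= n -> exists j R', [/\ j <= 1 + k * (T + 5),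
    run P (Config off R) j = Config (off + 1) R' & represents A (sk k) R'].
  elim: k => [|k IH] Hk.
    exists 1, (upd R (vreg x) 0); split => //; last exact: repr_vreg.
    exact: (run_one _ C0).
  have [j [R1 [Kj Ej HR1]]] := IH (ltnW Hk).
  have S1 : run P (Config (off + 1) R1) 1 =
      Config (off + 2) (upd R1 (sreg 0) (n - k)).
    rewrite (run_one _ C1) // E2; congr Config; case: HR1 => _ _ Hv _.
    by rewrite /= !Hv //= eqxx (negbTE yx) frame ?inE ?negb_or ?yx.
  have HR2 : represents A (sk k) (upd R1 (sreg 0) (n - k)) by exact: repr_sreg.
  have S2 := run_jz (upd R1 (sreg 0) (n - k)) C2.
  rewrite updE eqxx ifF ?E3 in S2; last by lia.
  have [j3 [R3 [K3 E4 HR3]]] := Hc k _ (frame k) _ _ _ _ C3 HR2.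
  have S4 := run_one R3 C5 isT.
  have S5 := run_one (upd R3 (sreg 0) 1) C6 isT.
  have S6 := run_jmp _ C7.
  exists (j + (1 + (1 + (j3 + (1 + (1 + 1)))))); eexists; split.
  - by rewrite mulSn; lia.
  - rewrite run_add Ej run_add S1 run_add S2 run_add E4 run_add S4 run_add S5.
    exact: S6.
  have HR4 : represents A (ex c (sk k)) (upd R3 (sreg 0) 1) by exact: repr_sreg.
  have Vx : upd R3 (sreg 0) 1 (vreg x) = k.
    by case: HR4 => _ _ -> // _; rewrite ex_var //= eqxx.
  apply: repr_ext (repr_vreg _ Hx HR4) _ _ => //.
  by move=> z; rewrite /sk /= /f; case: eqP => // _; rewrite Vx updE eqxx addn1.
have [j [R1 [Kj Ej HR1]]] := loop n (leqnn n).
have S1 : run P (Config (off + 1) R1) 1 = Config (off + 2) (upd R1 (sreg 0) 0).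
  rewrite (run_one _ C1) // E2; congr Config; case: HR1 => _ _ Hv _.
  by rewrite /= !Hv //= eqxx (negbTE yx) frame ?inE ?negb_or ?yx // subnn.
have S2 := run_jz (upd R1 (sreg 0) 0) C2.
rewrite updE eqxx eqxx in S2.
exists (j + (1 + 1)), (upd R1 (sreg 0) 0); split; first by lia.
- rewrite run_add Ej run_add S1 S2; congr Config.
  by rewrite /= size_cat /= -/lb; lia.
exact: repr_sreg.
Qed.

Lemma time_bound_eq c sigma sigma' :
  (forall y, y \in loop_vars c -> sigma y = sigma' y) ->
  time_bound c sigma = time_bound c sigma'.
Proof.
by move=> H; congr (_ * _); apply: eq_big_seq => y Hy; rewrite H.
Qed.

(** Stability lets every bound be read in [s], also inside loops and after a first command. A sum of
    two time bounds is below the sum of the weights times both products, because each product is at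
    least 1. *)
Lemma correct_stable c s : wf c -> stable c -> correct c s (time_bound c (var s)).
Proof.
elim: c s => [|x e|a e1 e2|c1 H1 c2 H2|e c1 H1 c2 H2|x y c1 H1] s.
- move=> _ _ A P off R _ HR; exists 0, R; split => //.
  by rewrite /= addn0.
- move=> /andP[Hx We] _ A P off R C HR.
  have := run_straight R C; rewrite all_cat straight_cexpr => /(_ isT) E.
  have [Re _ Ve] := cexprP We HR.
  exists (weight (Asn x e)); eexists; split.
  + by rewrite /time_bound big_nil muln1.
  + by rewrite /= size_cat in E *; exact: E.
  rewrite foldl_cat /= !updE eqxx /= Ve addn0.
  by apply: repr_vreg => //; apply: repr_sreg.
- move=> /and3P[Ha W1 W2] _ A P off R C HR.
  have {}C : code_at P off (cexpr 0 e1 ++ addr_code a 0 ++ cexpr 1 e2 ++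
      [:: IStore (sreg 0) (sreg 1)]) by exact: C.
  have := run_straight R C.
  rewrite !all_cat !straight_cexpr [all _ (addr_code _ _)]/= => /(_ isT) E.
  have [R1 _ V1] := cexprP W1 HR.
  have [R2 _ V2] := addr_codeP Ha (isT : 1 < 60) R1.
  have [R3 P3 V3] := cexprP W2 R2.
  have Es : size (compile off (Put a e1 e2)) = weight (Put a e1 e2).
    by rewrite /= !size_cat /= size_cat /=; lia.
  exists (weight (Put a e1 e2)); eexists; split.
  + by rewrite /time_bound big_nil muln1.
  + by rewrite -Es; exact: E.
  move: V2 P3 V3 R3; rewrite !foldl_cat; set R4 := foldl _ _ (addr_code _ _).
  move=> V2 P3 V3 R3; rewrite [foldl _ _ [:: _]]/= P3 // V2 V1 V3.
  exact: repr_seta.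
- move=> /andP[W1 W2]; rewrite /stable /= all_cat => /andP[S1 S2].
  have {}S1' : stable c1.
    by apply: sub_all S1 => y; rewrite mem_cat negb_or => /andP[].
  have S2' : stable c2.
    by apply: sub_all S2 => y; rewrite mem_cat negb_or => /andP[].
  apply: correct_leq (correct_seq (H1 s W1 S1') (H2 _ W2 S2')).
  rewrite (@time_bound_eq c2 _ (var s)); last first.
    move=> y /(allP S2); rewrite mem_cat negb_or => /andP[y1 _].
    by rewrite ex_var.
  rewrite /time_bound /= big_cat /=.
  have := prod_loop_gt0 c1 (var s); have := prod_loop_gt0 c2 (var s).
  by nia.
- move=> /and3P[We W1 W2]; rewrite /stable /= all_cat => /andP[S1 S2].
  have {}S1' : stable c1.
    by apply: sub_all S1 => y; rewrite mem_cat negb_or => /andP[].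
  have S2' : stable c2.
    by apply: sub_all S2 => y; rewrite mem_cat negb_or => /andP[].
  apply: correct_leq (correct_if We (fun _ => H1 s W1 S1') (fun _ => H2 s W2 S2')).
  rewrite /time_bound /= big_cat /=.
  have := prod_loop_gt0 c1 (var s); have := prod_loop_gt0 c2 (var s).
  by nia.
move=> /and4P[Hx Hy xc W1]; rewrite /stable /= => /andP[yc S1].
have S1' : stable c1.
  by apply: sub_all S1 => z; rewrite inE negb_or => /andP[].
have Hc k s' : (forall z, z \notin x :: mods c1 -> var s' z = var s z) ->
    correct c1 (setv s' x k) (time_bound c1 (var s)).
  move=> Hs'; rewrite (@time_bound_eq c1 _ (var (setv s' x k))); first exact: H1.
  move=> z /(allP S1) Hz; rewrite /= -(Hs' _ Hz) ifF //.
  by move: Hz; rewrite inE negb_or => /andP[/negbTE].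
apply: correct_leq (correct_for Hx Hy xc yc Hc).
rewrite /time_bound /= big_cons.
have := prod_loop_gt0 c1 (var s).
set p := \prod_(_ <- _) _; set n := var s y; set K := weight c1.
by nia.
Qed.

(** * Relocating the input *)

(* The input fills the low registers, so they are first spilled: doubling
   register 0 gives the free address [A = 128 * size x] without any scratch
   register, and the entries are then copied to [A, A + 8, A + 16, ...], the
   cells of array 0. *)
Definition relocate : seq instr :=
  [:: IAdd 0 0 0; IAdd 0 0 0; IAdd 0 0 0; IAdd 0 0 0; IAdd 0 0 0; IAdd 0 0 0;
      IAdd 0 0 0; IStore 0 1; IConst 1 8;
      IAdd 0 0 1; IStore 0 2; IAdd 0 0 1; IStore 0 3; IAdd 0 0 1; IStore 0 4;
      IAdd 0 0 1; IStore 0 5; IConst 2 32; ISub 3 0 2; IConst 2 6;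
      ISub 4 3 2; IJz 4 28; IAdd 0 0 1; ILoad 5 2; IStore 0 5; IConst 4 1;
      IAdd 2 2 4; IJmp 20].

(** After [j] entries are copied, [R 0] points at the last cell written. Registers from [b] on,
    outside the written cells, keep their initial contents; register [i] initially holds entry
    [i.-1]. *)
Definition copied (x : seq nat) (b j : nat) (R : nat -> nat) : Prop :=
  let A := 128 * size x in
  [/\ R 0 + 8 = A + 8 * j, R 1 = 8, forall i, i < j -> R (A + 8 * i) = nth 0 x i
    & forall i, b <= i -> (forall i', i' < j -> i <> A + 8 * i') ->
        R i = nth 0 x i.-1].

Lemma copied_store x b j R v : 0 < size x -> 2 <= b -> v = nth 0 x j ->
  copied x b j R ->
  copied x b j.+1 (upd (upd R 0 (R 0 + R 1)) (R 0 + R 1) v).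
Proof.
move=> Hx Hb -> [H0 H1 Hc Hr]; rewrite /upd H1 H0; split.
- by rewrite ifF ?eqxx; lia.
- by rewrite !ifF //; lia.
- move=> i Hi; case: eqP => E; first by congr nth; lia.
  by rewrite ifF ?Hc; lia.
move=> i Hi Hn; rewrite !ifF; [|lia|].
  by apply: Hr => // i' Hi'; apply: Hn; lia.
by apply/eqP; apply: Hn.
Qed.

Lemma copied_upd x j R r v :
  2 <= r < 6 -> 0 < size x -> copied x 6 j R -> copied x 6 j (upd R r v).
Proof.
move=> Hr Hx [H0 H1 Hc Hn]; rewrite /upd; split.
- by rewrite ifF //; lia.
- by rewrite ifF //; lia.
- by move=> i Hi; rewrite ifF ?Hc //; lia.
by move=> i Hi Hni; rewrite ifF; [exact: Hn|lia].
Qed.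

Lemma copied_init x : 0 < size x ->
  copied x 2 1 (foldl exec1 (regs (init x)) (take 9 relocate)).
Proof.
move=> Hx; pose R := foldl exec1 (regs (init x)) (take 7 relocate).
have EA : R 0 = 128 * size x by rewrite /R /= /upd /=; lia.
have ER i : 0 < i -> R i = nth 0 x i.-1 by case: i.
rewrite -[foldl _ _ _]/(upd (upd R (R 0) (R 1)) 1 8) EA.
clearbody R; rewrite /upd; split=> //=.
- by rewrite ifF ?EA; lia.
- move=> i; rewrite ltnS leqn0 => /eqP->; rewrite muln0 addn0 eqxx ifF ?ER //; lia.
move=> i Hi Hn; have /eqP/negbTE := Hn 0 isT; rewrite muln0 addn0 => ->.
by rewrite ifF ?ER //; lia.
Qed.

(** The length of [x] is lost by the doublings, so the copying runs until the source pointer reaches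
    [A]; the surplus entries are zeros. The cells of the other arrays are never written and lie
    beyond the input, so they are 0. *)
Lemma relocateP x P : 0 < size x -> code_at P 0 relocate ->
  exists k R, [/\ k <= 1024 * size x, run P (init x) k = Config (size relocate) R
    & represents (128 * size x)
        (State (fun y => R (vreg y)) (fun a j => if a == 0 then nth 0 x j else 0)) R].
Proof.
move=> Hx C; set A := 128 * size x.
have HA : 128 <= A by rewrite /A; lia.
have [C9 C'] := @code_at_cat P 0 (take 9 relocate) (drop 9 relocate) C.
have S9 := run_straight (regs (init x)) C9 isT.
have I1 := copied_init Hx.
move: S9 I1; set R1 := foldl _ _ _ => S9 I1.
have [C20 C''] := @code_at_cat P 9 (take 11 (drop 9 relocate)) (drop 20 relocate) C'.
have S20 := run_straight R1 C20 isT.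
have rd j R : 1 < j.+1 < A -> copied x 2 j R -> upd R 0 (R 0 + R 1) j.+1 = nth 0 x j.
  by move=> Hj [_ _ _ Hr]; rewrite /upd /= Hr //; lia.
have st j R : 1 < j.+1 < A -> copied x 2 j R -> copied x 2 j.+1
    (foldl exec1 R [:: IAdd 0 0 1; IStore 0 j.+1]).
  move=> Hj I; rewrite /= {2}/upd /=; apply: copied_store => //; exact: rd.
(* Five entries are copied by straight-line code, which frees registers 2 to 5 for the loop. *)
have I5 : copied x 2 5 (foldl exec1 R1 (take 8 (drop 9 relocate))).
  have /= := st 4 _ _ (st 3 _ _ (st 2 _ _ (st 1 _ _ I1))).
  by apply; lia.
have ER : foldl exec1 R1 (take 11 (drop 9 relocate)) =
   foldl exec1 (foldl exec1 R1 (take 8 (drop 9 relocate)))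
     [:: IConst 2 32; ISub 3 0 2; IConst 2 6] by [].
have {}S20 : run P (init x) 20 = Config 20 (foldl exec1
    (foldl exec1 R1 (take 8 (drop 9 relocate)))
    [:: IConst 2 32; ISub 3 0 2; IConst 2 6]).
  by rewrite (run_add _ _ 9 11) (S9 : run P (init x) 9 = _) -ER; exact: S20.
move: S20 I5 {ER}; move: (foldl exec1 R1 _) => R5 S20 I5.
have J : copied x 6 5 R5.
  by case: I5 => H0 H1 H2 H3; split => // i Hi; apply: H3; lia.
have I6 : copied x 6 5 (foldl exec1 R5 [:: IConst 2 32; ISub 3 0 2; IConst 2 6]).
  by do 3!(apply: copied_upd => //).
have Q2 : foldl exec1 R5 [:: IConst 2 32; ISub 3 0 2; IConst 2 6] 2 = 6 by [].
have Q3 : foldl exec1 R5 [:: IConst 2 32; ISub 3 0 2; IConst 2 6] 3 = A.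
  by case: J => H0 _ _ _; rewrite /= /upd /= /A; lia.
move: S20 I6 Q2 Q3; move: (foldl exec1 R5 _) => R6 S20 I6 Q2 Q3.
have {C''} : code_at P 20 (drop 20 relocate) by exact: C''.
rewrite [drop _ _]/= => /code_at_cons[D0 /code_at_cons[D1 /code_at_cons[D2]]].
move=> /code_at_cons[D3 /code_at_cons[D4 /code_at_cons[D5 /code_at_cons[D6 D7]]]].
rewrite /= in D1 D2 D3 D4 D5 D6 D7.
(* Register 2 is the source pointer; it is one ahead of the number of copied entries because entry
   [i] sits in register [i + 1]. It stays below [A], so no source is overwritten before being
   read. *)
have loop q : q + 6 <= A -> exists R, [/\ run P (init x) (20 + q * 8) = Config 20 R,
    copied x 6 (q + 5) R, R 2 = q + 6 & R 3 = A].
  elim: q => [|q IH] Hq; first by exists R6.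
  have [|R [E I Eq E3]] := IH; first by lia.
  have Ed : R 3 - R 2 = (A - (q + 6).+1).+1 by rewrite Eq E3; lia.
  have rq : R (q + 6) = nth 0 x (q + 5).
    case: I => _ _ _ Hr; rewrite Hr; [by congr nth; lia|lia|].
    by move=> i' _; move: Hq; rewrite /A; lia.
  have H0 : R 0 + 8 = A + 8 * (q + 5) by case: I.
  have H1 : R 1 = 8 by case: I.
  have E0 : ((R 0 + R 1 == 0) = false) * ((R 0 + R 1 == 1) = false) *
      ((R 0 + R 1 == 2) = false) * ((R 0 + R 1 == 3) = false) *
      ((R 0 + R 1 == 4) = false) * ((R 0 + R 1 == 5) = false).
    by rewrite H1 H0 ; do !split; lia.
  pose Ra := upd R 4 (R 3 - R 2).
  pose Rb := upd (upd (upd Ra 0 (R 0 + R 1)) 5 (nth 0 x (q + 5)))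
                 (R 0 + R 1) (nth 0 x (q + 5)).
  exists (upd (upd Rb 4 1) 2 (q.+1 + 6)); split.
  - rewrite mulSn -addnCA addnC run_add E.
    rewrite -[8]/(1 + (1 + (1 + (1 + (1 + (1 + (1 + 1))))))).
    have Ra4 : (Ra 4 == 0) = false by rewrite /Ra updE eqxx Ed.
    rewrite run_add (run_one _ D0) // -[exec1 R _]/Ra run_add (run_jz _ D1) Ra4.
    rewrite run_add (run_one _ D2) // run_add (run_one _ D3) //.
    rewrite run_add (run_one _ D4) // run_add (run_one _ D5) //.
    rewrite run_add (run_one _ D6) // (run_jmp _ D7) /=; congr Config.
    have -> : upd Ra 0 (Ra 0 + Ra 1) (upd Ra 0 (Ra 0 + Ra 1) 2) = nth 0 x (q + 5).
      by rewrite /upd /Ra /= /upd /= Eq; rewrite !ifF -?rq //; lia.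
    have X5 : upd (upd Ra 0 (Ra 0 + Ra 1)) 5 (nth 0 x (q + 5)) 0 = R 0 + R 1 by [].
    have -> : upd (upd Ra 0 (Ra 0 + Ra 1)) 5 (nth 0 x (q + 5)) 5 = nth 0 x (q + 5) by [].
    rewrite X5 -[upd (upd _ 5 _) (R 0 + R 1) _]/Rb.
    have Rb2 : Rb 2 = q + 6 by rewrite /Rb updE eq_sym E0 -Eq.
    congr (upd _ _ _); rewrite -[upd _ 4 1 2]/(Rb 2) -[upd _ 4 1 4]/1 Rb2.
    by lia.
  - have -> : q.+1 + 5 = (q + 5).+1 by lia.
    do 2!(apply: copied_upd => //).
    have Ib : copied x 6 (q + 5) (upd Ra 5 (nth 0 x (q + 5))).
      by do 2!(apply: copied_upd => //).
    have := copied_store Hx (isT : 1 < 6) (erefl (nth 0 x (q + 5))) Ib.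
    case=> G0 G1 G2 G3; rewrite /Rb; split.
    + by move: G0; rewrite /upd /=.
    + by move: G1; rewrite /upd /=.
    + move=> i Hi; rewrite -(G2 i Hi) /upd /=; do !case: ifP => //; lia.
    + move=> i Hi Hn; rewrite -(G3 i Hi Hn) /upd /=; do !case: ifP => //; lia.
  - by [].
  by rewrite -[upd _ 2 _ 3]/(Rb 3) /Rb updE eq_sym E0.
have [|R [E I E2 E3]] := loop (A - 6); first by lia.
have {}E2 : R 2 = A by lia.
exists (20 + (A - 6) * 8 + (1 + 1)), (upd R 4 0); split.
- by rewrite -/A; lia.
- rewrite run_add E run_add (run_one _ D0) // (run_jz _ D1) /= E2 E3 subnn.
  by rewrite updE eqxx.
have ini0 i : size x < i -> nth 0 x i.-1 = 0.
  by move=> Hi; rewrite nth_default //; lia.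
have {I} [_ _ Hc Hr] : copied x 6 (A - 6 + 5) (upd R 4 0) by exact: copied_upd.
rewrite -/A in Hc Hr.
split => // a i Ha; rewrite [arr _ _ _]/=.
case: eqP => [->|Na]; last first.
  by rewrite Hr; [apply: ini0; lia|lia|move=> i' _; lia].
rewrite addn0; case: (ltnP i (A - 6 + 5)) => Hi; first exact: Hc.
rewrite Hr; [|lia|move=> i' Hi'; lia].
by rewrite ini0; [rewrite nth_default //; lia|lia].
Qed.

Definition finish (x : nat) : seq instr := [:: IConst 60 0; IAdd 0 (vreg x) 60].

Definition assemble (c : cmd) (x : nat) : program :=
  relocate ++ compile (size relocate) c ++ finish x.

Lemma halted_run P c k j : k <= j -> halted P (run P c k) -> run P c j = run P c k.
Proof.
move=> /subnKC<-; rewrite run_add; move: (run P c k) => d Hd.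
elim: (j - k) => // i IH; rewrite -addn1 run_add IH /run /= /step.
by move: Hd; rewrite /halted; case: nth.
Qed.

(** Relocation leaves arbitrary values in the variables, so only the arrays of [s] are known. A
    halted configuration no longer changes, so the output may be read at any [T'] that is large
    enough. *)
Lemma assembleP c y x T : 0 < size x -> y < 50 ->
  (forall s, (forall a j, arr s a j = if a == 0 then nth 0 x j else 0) ->
     correct c s T) ->
  exists s, (forall a j, arr s a j = if a == 0 then nth 0 x j else 0) /\
  forall T', 1024 * size x + T + 2 <= T' ->
  outputs_within (assemble c y) x T' (var (ex c s) y).
Proof.
move=> Hx Hy Hc.
have HP : code_at (assemble c y) 0 (assemble c y) by move=> i _.
have [C0 C1] := code_at_cat HP; have [C2 C3] := code_at_cat C1.
have [k [R [Hk E HR]]] := relocateP Hx C0.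
set s := State _ _ in HR; exists s; split => // T' HT'.
have [k2 [R2 [Hk2 E2 HR2]]] := Hc s (fun a j => erefl) _ _ _ _ C2 HR.
have E3 := run_straight R2 C3 isT.
pose K := k + (k2 + 2).
have EK : run (assemble c y) (init x) K =
    Config (size (assemble c y)) (foldl exec1 R2 (finish y)).
  rewrite /K run_add E run_add E2 E3; congr Config.
  by rewrite /assemble !size_cat addnA.
(* The program counter is just past the end, where the default instruction is [IHalt]. *)
have HH : halted (assemble c y) (run (assemble c y) (init x) K).
  by rewrite EK /halted /= nth_default.
rewrite /outputs_within (halted_run _ HH); last by rewrite /K; lia.
split=> //; rewrite EK /= /upd /=; case: HR2 => _ _ Hv _.
by rewrite addn0 -(Hv y Hy) ifF // /vreg; lia.
Qed.

(** * The algorithm *)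

(** Loop rule. The invariant must ignore the loop variable, which is overwritten before each round
    and on exit. Whatever the body does not write is known to be unchanged, so invariants need only
    describe what changes. *)
Lemma for_ind (I : nat -> state -> Prop) x y c s :
  (forall k s' v, I k s' -> I k (setv s' x v)) -> I 0 s -> x \notin mods c ->
  (forall k s', k < var s y -> var s' x = k ->
    (forall z, z \notin x :: mods c -> var s' z = var s z) ->
    (forall a, a \notin amods c -> arr s' a = arr s a) ->
    I k s' -> I k.+1 (ex c s')) ->
  I (var s y) (ex (For x y c) s).
Proof.
move=> Iset I0 xc Istep /=; apply: (Iset).
pose J k s' := [/\ I k s', (forall z, z \notin x :: mods c -> var s' z = var s z)
  & (forall a, a \notin amods c -> arr s' a = arr s a)].
suff [] : J (var s y) (iteri (var s y) (fun k s1 => ex c (setv s1 x k)) s) by [].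
apply: iteri_ind => [|k s' kn [IJ Fv Fa]]; first by split.
have Gv z : z \notin x :: mods c -> var (setv s' x k) z = var s z.
  by move=> Hz; rewrite /= ifF ?Fv //; move: Hz; rewrite inE negb_or => /andP[/negbTE].
split.
- by apply: Istep => //=; [rewrite eqxx|exact: Iset].
- by move=> z Hz; rewrite ex_var ?Gv //; move: Hz; rewrite inE negb_or => /andP[].
- by move=> a Ha; rewrite ex_arr // /= Fa.
Qed.

Lemma ex_seq c1 c2 s : ex (Seq c1 c2) s = ex c2 (ex c1 s).
Proof. by []. Qed.

Lemma ex_if e c1 c2 s : ex (If e c1 c2) s = if ev e s == 0 then ex c2 s else ex c1 s.
Proof. by []. Qed.

Notation "c1 ;; c2" := (Seq c1 c2) (at level 90, right associativity).

Notation vT := 0 (only parsing).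
Notation vM := 1 (only parsing).
Notation vP := 2 (only parsing).
Notation vL := 3 (only parsing).
Notation vN := 4 (only parsing).
Notation vS := 5 (only parsing).
Notation vE := 6 (only parsing).
Notation vAns := 7 (only parsing).
Notation vI := 8 (only parsing).
Notation vJ := 9 (only parsing).
Notation vK := 10 (only parsing).
Notation vC := 11 (only parsing).
Notation vTh := 12 (only parsing).
Notation vPtr := 13 (only parsing).
Notation vCnt := 14 (only parsing).
Notation vSame := 15 (only parsing).
Notation vOk := 16 (only parsing).
Notation vCarry := 17 (only parsing).
Notation vX := 18 (only parsing).
Notation vY := 19 (only parsing).
Notation vZ := 20 (only parsing).
Notation vIt := 21 (only parsing).

Notation aIn := 0 (only parsing).
Notation aOff := 1 (only parsing).
Notation aFull := 2 (only parsing).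
Notation aScore := 3 (only parsing).
Notation aKept := 4 (only parsing).
Notation aMask := 5 (only parsing).

(** With truncated subtraction this is the absolute difference, nonzero exactly when the values
    differ. *)
Definition eneq (e1 e2 : expr) := Add (Sub e1 e2) (Sub e2 e1).
(** [aOff] stores where the length of a vote sits in the input; its candidates follow, hence the
    shift by 1 in [eent]. *)
Definition elen (i : nat) := Get aIn (Get aOff (Var i)).
Definition eent (i k : nat) := Get aIn (Add (Get aOff (Var i)) (Add (Var k) (Cst 1))).

(* Points of the candidate at 0-based position [k] of a vote of length [len], in
   excess of the unranked candidates (and doubled for [BordaAv]). *)
Definition wt (d : borda_rule) (m len k : nat) : nat :=
  match d with
  | BordaUp => m - (k + 1)
  | BordaDown => len - k
  | BordaAv => (m + len) - (k + k + 1)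
  end.

Definition ewt (d : borda_rule) : expr :=
  match d with
  | BordaUp => Sub (Var vM) (Add (Var vK) (Cst 1))
  | BordaDown => Sub (elen vI) (Var vK)
  | BordaAv => Sub (Add (Var vM) (elen vI)) (Add (Add (Var vK) (Var vK)) (Cst 1))
  end.

(** The loop runs to [vT] under a guard instead of to the length of the vote: a bound must be a
    variable that never changes. *)
Definition score_vote (d : borda_rule) (a : nat) : cmd :=
  For vK vT (If (Sub (elen vI) (Var vK))
    (Put a (eent vI vK) (Add (Get a (eent vI vK)) (ewt d))) Skip).

(** A nonzero mask entry marks a deleted vote. *)
Definition score_cmd (d : borda_rule) (a : nat) : cmd :=
  For vC vM (Put a (Var vC) (Cst 0));;
  For vI vN (If (Get aMask (Var vI)) Skip (score_vote d a)).

(** The truncated difference [S + 1 - th] is nonzero exactly when [S >= th], so differing entries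
    break similarity as soon as one of them is bad. *)
Definition sim_cmd : cmd :=
  Asn vSame (Cst 1);;
  If (eneq (elen vI) (elen vJ)) (Asn vSame (Cst 0)) Skip;;
  For vK vT (If (Sub (elen vI) (Var vK))
    (If (eneq (eent vI vK) (eent vJ vK))
      (If (Add (Sub (Add (Get aFull (eent vI vK)) (Cst 1)) (Var vTh))
               (Sub (Add (Get aFull (eent vJ vK)) (Cst 1)) (Var vTh)))
        (Asn vSame (Cst 0)) Skip)
      Skip)
    Skip).

(** [vL - vCnt] is nonzero exactly when fewer than [l] earlier votes are similar. The mask is
    cleared so that each threshold starts its counter at the empty deletion set. *)
Definition kept_cmd : cmd :=
  For vI vN (
    Asn vCnt (Cst 0);;
    For vJ vN (If (Sub (Var vI) (Var vJ))
      (sim_cmd;; Asn vCnt (Add (Var vCnt) (Var vSame))) Skip);;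
    Put aKept (Var vI) (Sub (Var vL) (Var vCnt));;
    Put aMask (Var vI) (Cst 0)).

(** [vOk] starts as [l + 1] minus the number of deletions, nonzero exactly when the budget is
    respected. [vAns] is only ever raised to 1 here. *)
Definition test_cmd (d : borda_rule) : cmd :=
  score_cmd d aScore;;
  Asn vCnt (Cst 0);;
  For vI vN (Asn vCnt (Add (Var vCnt) (Get aMask (Var vI))));;
  Asn vOk (Sub (Add (Var vL) (Cst 1)) (Var vCnt));;
  For vC vM (If (eneq (Var vC) (Var vP))
    (If (Sub (Get aScore (Var vP)) (Get aScore (Var vC))) Skip (Asn vOk (Cst 0))) Skip);;
  If (Var vOk) (Asn vAns (Cst 1)) Skip.

Definition incr_cmd : cmd :=
  Asn vCarry (Cst 1);;
  For vI vN (If (Get aKept (Var vI))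
    (If (Var vCarry)
      (If (Get aMask (Var vI)) (Put aMask (Var vI) (Cst 0))
        (Put aMask (Var vI) (Cst 1);; Asn vCarry (Cst 0)))
      Skip)
    Skip).

Definition search_cmd (d : borda_rule) : cmd :=
  For vTh vS (kept_cmd;; For vIt vE (test_cmd d;; incr_cmd)).

(* One step of a binary counter, least significant bit first, that only uses
   the positions selected by [ks]. *)
Fixpoint incb (c : bool) (ks bs : seq bool) : seq bool :=
  match ks, bs with
  | k :: ks', b :: bs' =>
      (if k && c then ~~ b else b) :: incb (if k then c && b else c) ks' bs'
  | _, _ => bs
  end.

Lemma size_incb c ks bs : size (incb c ks bs) = size bs.
Proof. by elim: ks c bs => [|k ks IH] c [|b bs] //=; rewrite IH. Qed.

(** The carry reaches position [i] exactly when it enters and all selected bits below [i] are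
    set. *)
Lemma nth_incb c ks bs i : size ks = size bs -> i < size bs ->
  nth false (incb c ks bs) i =
  if nth false ks i && (c && all (fun j => nth false ks j ==> nth false bs j) (iota 0 i))
  then ~~ nth false bs i else nth false bs i.
Proof.
elim: ks c bs i => [|k ks IH] c [|b bs] [|i] //=; first by rewrite andbT.
move=> [Hs] Hi; rewrite IH // -[1]/(1 + 0) iotaDl all_map.
by case: k; case: b; case: c; rewrite ?andbF.
Qed.

(** * What the commands compute *)

Section Verification.

Variables (d : borda_rule) (t m p l n SM E : nat) (A0 A1 : nat -> nat).

Definition len i := A0 (A1 i).
Definition ent i k := A0 (A1 i + (k + 1)).

Record env (s : state) : Prop := Env {
  env_t : var s vT = t; env_m : var s vM = m; env_p : var s vP = p;
  env_l : var s vL = l; env_n : var s vN = n; env_S : var s vS = SM;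
  env_E : var s vE = E; env_in : arr s aIn = A0; env_off : arr s aOff = A1 }.

(** The fixed data occupy variables 0 to 6 and arrays 0 and 1, so their preservation is decided by
    computation on [mods] and [amods]. *)
Lemma env_frame c s s' :
  (forall z, z \notin mods c -> var s' z = var s z) ->
  (forall a, a \notin amods c -> arr s' a = arr s a) ->
  all (fun x => x \notin mods c) (iota 0 7) ->
  all (fun a => a \notin amods c) (iota 0 2) -> env s -> env s'.
Proof.
move=> Fv Fa /allP Hv /allP Ha [*].
have V x : x < 7 -> var s' x = var s x by move=> Hx; apply/Fv/Hv; rewrite mem_iota.
have W a : a < 2 -> arr s' a = arr s a by move=> Hx; apply/Fa/Ha; rewrite mem_iota.
by split; rewrite ?V ?W.
Qed.

Lemma env_ex c s :
  all (fun x => x \notin mods c) (iota 0 7) ->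
  all (fun a => a \notin amods c) (iota 0 2) -> env s -> env (ex c s).
Proof.
by apply: env_frame => [z Hz|a Ha]; [apply: ex_var|apply: ex_arr].
Qed.

Lemma ev_ewt s : env s -> ev (ewt d) s = wt d m (len (var s vI)) (var s vK).
Proof.
by move=> H; case: d; rewrite /= ?(env_in H) ?(env_off H) ?(env_m H).
Qed.

Definition vote_pts (i c : nat) : nat :=
  \sum_(0 <= k < t) ((k < len i) && (ent i k == c)) * wt d m (len i) k.

Lemma score_vote_spec a s c : 1 < a -> env s ->
  arr (ex (score_vote d a) s) a c = arr s a c + vote_pts (var s vI) c.
Proof.
move=> Ha He.
have := @for_ind (fun k s' => forall c, arr s' a c =
  arr s a c + \sum_(0 <= k' < k) ((k' < len (var s vI)) && (ent (var s vI) k' == c)) *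
   wt d m (len (var s vI)) k') vK vT
   (If (Sub (elen vI) (Var vK))
    (Put a (eent vI vK) (Add (Get a (eent vI vK)) (ewt d))) Skip) s.
rewrite (env_t He); apply => // [c0|k s' Hk Ek Fv Fa IH c0].
  by rewrite big_geq // addn0.
have He' : env s'.
  apply: (@env_frame (score_vote d a) s) => //=.
  by rewrite !inE; case: a Ha {Fa Fv IH} => [|[|]].
have EI : var s' vI = var s vI by exact: Fv.
rewrite big_nat_recr // addnA -IH /=.
rewrite ev_ewt // (env_in He') (env_off He') EI Ek -/(len _) -/(ent _ _).
rewrite subn_eq0 leqNgt; case: ltnP => /= Hlt; last by rewrite mul0n addn0.
rewrite eqxx [c0 == _]eq_sym; case: eqP => [->|_]; first by rewrite mul1n.
by rewrite mul0n addn0.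
Qed.

Lemma score_spec a s c : 1 < a -> a != 5 -> env s -> c < m ->
  arr (ex (score_cmd d a) s) a c =
  \sum_(0 <= i < n) (arr s aMask i == 0) * vote_pts i c.
Proof.
move=> Ha H5 He Hc; rewrite /score_cmd ex_seq; set c1 := For vC _ _.
have a01 : [/\ (a == 0) = false, (a == 1) = false & (5 == a) = false].
  by split; lia.
case: a01 => a0 a1 a5.
have Z : forall c, c < m -> arr (ex c1 s) a c = 0.
  have := @for_ind (fun k s' => forall c, c < k -> arr s' a c = 0) vC vM
    (Put a (Var vC) (Cst 0)) s.
  rewrite (env_m He); apply => // k s' Hk Ek Fv Fa IH c0 Hc0.
  by rewrite /= eqxx Ek; case: eqP => // Ne; apply: IH; lia.
have He1 : env (ex c1 s).
  by apply: env_ex => //=; rewrite !inE ![_ == a]eq_sym a0 a1.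
have E5 : arr (ex c1 s) 5 = arr s 5 by apply: ex_arr; rewrite /= inE a5.
suff : arr (ex (For vI vN (If (Get aMask (Var vI)) Skip (score_vote d a))) (ex c1 s)) a c =
    arr (ex c1 s) a c + \sum_(0 <= i < n) (arr (ex c1 s) aMask i == 0) * vote_pts i c.
  by rewrite Z // E5.
move: (ex c1 s) He1 => {Z E5 He}s He1.
have := @for_ind (fun i s' => arr s' a c =
  arr s a c + \sum_(0 <= i' < i) (arr s 5 i' == 0) * vote_pts i' c) vI vN
  (If (Get aMask (Var vI)) Skip (score_vote d a)) s.
rewrite (env_n He1); apply => // [|i s' Hi Ei Fv Fa IH].
  by rewrite big_geq // addn0.
have He' : env s'.
  apply: (@env_frame (For vI vN (score_vote d a)) s) => //=.
  by rewrite !inE ![_ == a]eq_sym a0 a1.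
have E5 : arr s' 5 = arr s 5 by apply: Fa; rewrite /= inE a5.
rewrite big_nat_recr // addnA -IH /= Ei E5; case: eqP => _.
  by rewrite -/(ex (score_vote d a) s') score_vote_spec // Ei mul1n.
by rewrite mul0n addn0.
Qed.

Definition similar (S0 : nat -> nat) (th i j : nat) : bool :=
  (len i == len j) && all (fun k => (k < len i) ==> ((ent i k == ent j k) ||
    (S0 (ent i k) < th) && (S0 (ent j k) < th))) (iota 0 t).

Lemma sim_spec s : env s ->
  var (ex sim_cmd s) vSame = similar (arr s aFull) (var s vTh) (var s vI) (var s vJ).
Proof.
move=> He; rewrite /sim_cmd !ex_seq.
set c2 := If (eneq (elen vI) _) _ _.
set s1 := ex c2 _; set i := var s vI; set j := var s vJ; set th := var s vTh.
have V1 : var s1 vSame = (len i == len j).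
  rewrite /s1 /c2 /= (env_in He) (env_off He) -!/(len _).
  rewrite addn_eq0 !subn_eq0 -eqn_leq.
  by case: eqP.
have [I1 J1 T1] : [/\ var s1 vI = i, var s1 vJ = j & var s1 vTh = th].
  by rewrite /s1; split; rewrite ex_var.
have A2 : arr s1 aFull = arr s aFull by rewrite /s1 ex_arr.
have He1 : env s1 by rewrite /s1 -ex_seq; apply: env_ex.
rewrite -A2 /similar; move: s1 He1 I1 J1 T1 V1 {A2} => s1 He1 I1 J1 T1 V1.
set q := fun k : nat => _.
have := @for_ind (fun k s' => var s' vSame = (len i == len j) && all q (iota 0 k))
  vK vT (If (Sub (elen vI) (Var vK))
    (If (eneq (eent vI vK) (eent vJ vK))
      (If (Add (Sub (Add (Get aFull (eent vI vK)) (Cst 1)) (Var vTh))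
               (Sub (Add (Get aFull (eent vJ vK)) (Cst 1)) (Var vTh)))
        (Asn vSame (Cst 0)) Skip)
      Skip)
    Skip) s1.
rewrite (env_t He1).
apply => // [|k s' Hk Ek Fv Fa IH].
  by rewrite V1 andbT.
have He' : env s' by apply: (@env_frame (For vK vT (Asn vSame (Cst 0))) s1).
have EI : var s' vI = i by rewrite Fv.
have EJ : var s' vJ = j by rewrite Fv.
have ET : var s' vTh = th by rewrite Fv.
have EA : arr s' aFull = arr s1 aFull by exact: Fa.
rewrite -[k.+1]addn1 iotaD all_cat add0n andbA.
rewrite /= (env_in He') (env_off He') EI EJ ET EA Ek -!/(len _) -!/(ent _ _).
rewrite subn_eq0 leqNgt andbT /q; case: ltnP => /= Hlt; last by rewrite andbT IH.
rewrite addn_eq0 !subn_eq0 -eqn_leq; case: eqP => [->|_] /=; first by rewrite andbT IH.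
rewrite addn_eq0 !subn_eq0 !addn1; case: andP => /= H.
  by rewrite IH andbT.
by rewrite andbF.
Qed.

Definition kept_vote (S0 : nat -> nat) (th i : nat) : bool :=
  \sum_(0 <= j < n) ((j < i) && similar S0 th i j) < l.

Lemma kept_spec s i : env s -> i < n ->
  (arr (ex kept_cmd s) aKept i != 0) = kept_vote (arr s aFull) (var s vTh) i /\
  arr (ex kept_cmd s) aMask i = 0.
Proof.
move=> He; move: i; set S0 := arr s aFull; set th := var s vTh.
rewrite /kept_cmd; set body := (X in For vI vN X).
have := @for_ind (fun k s' => forall i, i < k ->
  (arr s' aKept i != 0) = kept_vote S0 th i /\ arr s' aMask i = 0) vI vN body s.
rewrite (env_n He); apply => // k s' Hk Ek Fv Fa IH i Hi.
have He' : env s' by apply: (@env_frame kept_cmd s).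
rewrite /body !ex_seq; set c2 := For vJ _ _; set s1 := ex _ s'.
have He1 : env s1 by apply: env_ex.
have E1 : var (ex c2 s1) vCnt = \sum_(0 <= j < n) ((j < k) && similar S0 th k j).
  have := @for_ind (fun j s2 => var s2 vCnt = \sum_(0 <= j' < j) ((j' < k) && similar S0 th k j'))
    vJ vN (If (Sub (Var vI) (Var vJ))
      (sim_cmd;; Asn vCnt (Add (Var vCnt) (Var vSame))) Skip) s1.
  rewrite (env_n He1); apply => // [|j s2 Hj Ej Gv Ga IHj].
    by rewrite big_geq.
  have He2 : env s2 by apply: (@env_frame c2 s1).
  have EI : var s2 vI = k by rewrite Gv.
  have EA : arr s2 aFull = S0 by rewrite Ga // Fa.
  have ET : var s2 vTh = th by rewrite Gv // /s1 ex_var // Fv.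
  rewrite big_nat_recr // -IHj ex_if [ev _ _]/= EI Ej subn_eq0 leqNgt.
  case: ltnP => Hjk; last by rewrite /= addn0.
  rewrite [negb _]/= ex_seq.
  rewrite -[var _ 14]/(var (ex sim_cmd s2) vCnt + var (ex sim_cmd s2) vSame).
  by rewrite sim_spec // ex_var // EI Ej EA ET.
have EK : var (ex c2 s1) vI = k by rewrite !ex_var.
have EL : var (ex c2 s1) vL = l by rewrite ex_var //; case: He1.
have F4 : arr (ex c2 s1) aKept = arr s' aKept by rewrite !ex_arr.
have F5 : arr (ex c2 s1) aMask = arr s' aMask by rewrite !ex_arr.
move: E1 EK EL F4 F5; move: (ex c2 s1) => s2 E1 EK EL F4 F5.
rewrite /= EK EL E1 F4 F5; case: (eqVneq i k) => [->|/eqP Ne].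
  by rewrite subn_eq0 -ltnNge.
by apply: IH; lia.
Qed.

Definition score_without (bs : seq bool) (c : nat) : nat :=
  \sum_(0 <= i < n) ~~ nth false bs i * vote_pts i c.

Definition wins (bs : seq bool) : bool :=
  all (fun c => (c == p) || (score_without bs c < score_without bs p)) (iota 0 m).

Definition passes (bs : seq bool) : bool :=
  (\sum_(0 <= i < n) nth false bs i <= l) && wins bs.

Lemma test_spec s bs : env s -> p < m ->
  (forall i, i < n -> arr s aMask i = nth false bs i) ->
  var (ex (test_cmd d) s) vAns = if passes bs then 1 else var s vAns.
Proof.
move=> He Hp Hb; rewrite /test_cmd 5!ex_seq.
have He1 : env (ex (score_cmd d aScore) s) by apply: env_ex.
have S1 c : c < m -> arr (ex (score_cmd d aScore) s) aScore c = score_without bs c.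
  move=> Hc; rewrite score_spec //; apply: eq_big_nat => i /andP[_ Hi].
  by rewrite Hb //; case: nth.
have M1 : arr (ex (score_cmd d aScore) s) aMask = arr s aMask by rewrite ex_arr.
have A1' : var (ex (score_cmd d aScore) s) vAns = var s vAns by rewrite ex_var.
move: S1 M1 A1' He1; move: (ex (score_cmd d aScore) s) => s1 S1 M1 A1' He1.
rewrite [ex (Asn vCnt _) _]/=; set s2 := setv _ _ _.
have He2 : env s2 by exact: (@env_ex (Asn vCnt (Cst 0)) s1 isT isT He1).
set c3 := For vI _ _.
have C3 : var (ex c3 s2) vCnt = \sum_(0 <= i < n) nth false bs i.
  have := @for_ind (fun i s3 => var s3 vCnt = \sum_(0 <= i' < i) nth false bs i')
    vI vN (Asn vCnt (Add (Var vCnt) (Get aMask (Var vI)))) s2.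
  rewrite (env_n He2); apply => // [|i s3 Hi Ei Gv Ga IH].
    by rewrite big_geq.
  by rewrite big_nat_recr //= -IH Ei Ga //= M1 Hb.
have He3 : env (ex c3 s2) by apply: env_ex.
have S3 : arr (ex c3 s2) aScore = arr s1 aScore by rewrite ex_arr.
have A3 : var (ex c3 s2) vAns = var s vAns by rewrite ex_var.
move: He3 S3 A3 C3; move: (ex c3 s2) => s3 He3 S3 A3 C3.
rewrite [ex (Asn vOk _) _]/= (env_l He3) C3; set s4 := setv _ _ _.
have He4 : env s4.
  by apply: (@env_frame (Asn vOk (Cst 0)) s3) => // z; rewrite inE /= => /negbTE->.
set c5 := For vC _ _.
have C5 : (var (ex c5 s4) vOk != 0) = passes bs.
  have := @for_ind (fun k s5 => (var s5 vOk != 0) =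
      (\sum_(0 <= i < n) nth false bs i <= l) &&
      all (fun c => (c == p) || (score_without bs c < score_without bs p)) (iota 0 k))
    vC vM (If (eneq (Var vC) (Var vP))
    (If (Sub (Get aScore (Var vP)) (Get aScore (Var vC))) Skip (Asn vOk (Cst 0))) Skip) s4.
  rewrite (env_m He4); apply => // [|k s5 Hk Ek Gv Ga IH].
    by rewrite /= andbT -lt0n subn_gt0 addn1.
  have EP : var s5 vP = p by rewrite Gv //; case: He4.
  have EA : arr s5 aScore = arr s1 aScore by rewrite Ga.
  rewrite -[k.+1]addn1 iotaD all_cat add0n andbA -IH /= andbT EP Ek EA.
  rewrite addn_eq0 !subn_eq0 -eqn_leq; case: (eqVneq k p) => _ /=; first by rewrite andbT.
  rewrite !S1 // leqNgt; case: ltnP => _ /=; first by rewrite andbT.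
  by rewrite andbF.
have A5 : var (ex c5 s4) vAns = var s vAns by rewrite ex_var.
by rewrite /= -C5; case: eqP.
Qed.

Lemma incr_spec s ks bs : env s -> size ks = n -> size bs = n ->
  (forall i, i < n -> (arr s aKept i != 0) = nth false ks i) ->
  (forall i, i < n -> arr s aMask i = nth false bs i) ->
  forall i, i < n -> arr (ex incr_cmd s) aMask i = nth false (incb true ks bs) i.
Proof.
move=> He Hks Hbs Hk Hb.
rewrite /incr_cmd; set body := (X in For vI vN X).
(* The test [i < n] gives the goal the shape of the invariant at [k = n]: positions below [k] are
   incremented, the others are old, and the carry is alive when all selected bits so far are set. *)
have : let s' := ex (For vI vN body) (setv s vCarry 1) in
  var s' vCarry = all (fun j => nth false ks j ==> nth false bs j) (iota 0 n) /\
  (forall i, i < n -> arr s' aMask i =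
     nth false (if i < n then incb true ks bs else bs) i).
  have := @for_ind (fun k s' =>
    var s' vCarry = all (fun j => nth false ks j ==> nth false bs j) (iota 0 k) /\
    (forall i, i < n -> arr s' aMask i =
      nth false (if i < k then incb true ks bs else bs) i)) vI vN body (setv s vCarry 1).
  have En : var (setv s vCarry 1) vN = n by case: He.
  rewrite En; apply => // k s' Hkn Ek Gv Ga [IC IM].
  have EK : arr s' aKept = arr s aKept by rewrite Ga.
  have Mk : arr s' aMask k = nth false bs k by rewrite IM // ltnn.
  have NI := @nth_incb true ks bs k.
  rewrite Hks Hbs in NI; have {}NI := NI erefl Hkn.
  rewrite -[k.+1]addn1 iotaD all_cat add0n addn1 /= andbT Ek EK -Hk // in NI *.
  have old i : i < n -> i <> k -> nth false (if i < k.+1 then incb true ks bs else bs) i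
     = nth false (if i < k then incb true ks bs else bs) i.
    by move=> Hi Hik; have -> : (i < k.+1) = (i < k) by lia.
  move: NI; case: eqP => K0 /=.
    move=> NI; rewrite andbT; split => // i Hi.
    case: (eqVneq i k) => [->|/eqP Ne]; first by rewrite Mk ltnSn NI.
    by rewrite IM // old.
  move: IC; case: (all _ _) => IC; rewrite IC /= => NI; last first.
    split => // i Hi.
    case: (eqVneq i k) => [->|/eqP Ne]; first by rewrite Mk ltnSn NI.
    by rewrite IM // old.
  rewrite Mk; move: NI; case: (nth false bs k) => /= NI; rewrite ?IC; split => // i Hi;
    (case: (eqVneq i k) => [->|/eqP Ne]; first by rewrite ltnSn NI);
    by rewrite IM // old.
move=> [_ H] i Hi; rewrite ex_seq.
by have := H i Hi; rewrite Hi.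
Qed.

Definition counter_mask (S0 : nat -> nat) (th e : nat) : seq bool :=
  iter e (incb true (mkseq (kept_vote S0 th) n)) (nseq n false).

Lemma size_masks S0 th e : size (counter_mask S0 th e) = n.
Proof. by elim: e => [|e IH]; rewrite /counter_mask /= ?size_nseq // size_incb. Qed.

Lemma search_spec s : env s -> p < m -> var s vAns = 0 ->
  var (ex (search_cmd d) s) vAns =
  has (fun th => has (fun e => passes (counter_mask (arr s aFull) th e)) (iota 0 E)) (iota 0 SM).
Proof.
move=> He Hp A0'; set S0 := arr s aFull.
rewrite /search_cmd; set body := kept_cmd;; _.
have := @for_ind (fun k s' => var s' vAns =
  has (fun th => has (fun e => passes (counter_mask S0 th e)) (iota 0 E)) (iota 0 k)) vTh vS body s.
rewrite (env_S He); apply => // th s1 Hth Eth Fv Fa IH.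
have He1 : env s1 by apply: (@env_frame (search_cmd d) s).
have ES : arr s1 aFull = S0 by rewrite Fa.
rewrite -[th.+1]addn1 iotaD has_cat add0n [has _ [:: th]]/= orbF.
rewrite /body ex_seq; set c2 := For vIt _ _; set s2 := ex kept_cmd s1.
have He2 : env s2 by apply: env_ex.
have A2 : var s2 vAns = has (fun th => has (fun e => passes (counter_mask S0 th e)) (iota 0 E)) (iota 0 th).
  by rewrite ex_var.
rewrite -[th in RHS]Eth in A2 *.
have K2 i : i < n -> (arr s2 aKept i != 0) = nth false (mkseq (kept_vote S0 th) n) i.
  by move=> Hi; rewrite nth_mkseq // -ES -Eth; case: (kept_spec He1 Hi).
have M2 i : i < n -> arr s2 aMask i = nth false (counter_mask S0 th 0) i.
  by move=> Hi; rewrite nth_nseq Hi; case: (kept_spec He1 Hi).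
(* The first disjunct carries over a success found at an earlier threshold. *)
have := @for_ind (fun e s3 => var s3 vAns = (var s2 vAns != 0) ||
    has (fun e => passes (counter_mask S0 th e)) (iota 0 e) /\
    (forall i, i < n -> arr s3 aMask i = nth false (counter_mask S0 th e) i))
  vIt vE (test_cmd d;; incr_cmd) s2.
rewrite (env_E He2) => H.
have [] : var (ex c2 s2) vAns = (var s2 vAns != 0) ||
    has (fun e => passes (counter_mask S0 th e)) (iota 0 E) /\
    (forall i, i < n -> arr (ex c2 s2) aMask i = nth false (counter_mask S0 th E) i).
  apply: H => // [|e s3 Hle Ee Gv Ga [IA IM]].
    by rewrite orbF A2; split => //; case: has.
  have He3 : env s3 by apply: (@env_frame c2 s2).
  have He4 : env (ex (test_cmd d) s3) by apply: env_ex.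
  have K3 : arr s3 aKept = arr s2 aKept by rewrite Ga.
  split.
    rewrite ex_seq ex_var // (test_spec He3 Hp IM) IA.
    rewrite -[e.+1]addn1 iotaD has_cat add0n [has _ [:: e]]/= orbF orbA.
    by case: passes; rewrite ?orbT ?orbF.
  rewrite ex_seq => i Hi; rewrite -[counter_mask _ _ e.+1]/(incb _ _ (counter_mask S0 th e)).
  apply: incr_spec => //; rewrite ?size_mkseq ?size_masks //.
    by move=> j Hj; rewrite ex_arr // K3 K2.
  by move=> j Hj; rewrite ex_arr // IM.
by move=> -> _; rewrite A2 Eth; case: has.
Qed.

End Verification.

(** * The kernel of first votes in each class *)

Lemma incb_false ks bs : incb false ks bs = bs.
Proof.
by elim: ks bs => [|k ks IH] [|b bs] //=; rewrite andbF if_same IH.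
Qed.

Lemma iter_incb_cons_skip e ks b bs :
  iter e (incb true (false :: ks)) (b :: bs) = b :: iter e (incb true ks) bs.
Proof. by elim: e => //= e ->. Qed.

(** Two steps restore the lowest bit and send exactly one carry upwards. *)
Lemma iter_incb_double e ks b bs :
  iter e.*2 (incb true (true :: ks)) (b :: bs) = b :: iter e (incb true ks) bs.
Proof. by elim: e => // e IH; rewrite doubleS !iterS IH; case: b {IH} => /=; rewrite !incb_false. Qed.

(** If the lowest position is selected, twice the steps needed for the tail set the higher bits, and
    one more sets the lowest bit if required. Unselected positions cost nothing. *)
Lemma counter_reaches ks bs : size bs = size ks ->
  (forall i, nth false bs i -> nth false ks i) ->
  exists2 e, e < 2 ^ count id ks
    & iter e (incb true ks) (nseq (size ks) false) = bs.
Proof.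
elim: ks bs => [|k ks IH] [|b bs] //=; first by exists 0.
move=> [Hs] Hsub; have [e He Ee] := IH bs Hs (fun i => Hsub i.+1).
case: k Hsub => Hsub.
  exists (b + e.*2); first by rewrite expnS -muln2; case: b {Hsub}; lia.
  rewrite iterD iter_incb_double Ee; case: b {Hsub} => //=.
  by rewrite incb_false.
have {Hsub} -> : b = false by move: (Hsub 0) => /=; case: b {Hsub} => // /(_ isT).
by exists e => //; rewrite iter_incb_cons_skip Ee.
Qed.

Section Kernel.

Variables (d : borda_rule) (t m l n : nat) (p : 'I_m) (A0 A1 : nat -> nat).
Variable S0 : nat -> nat.

Local Notation len := (len A0 A1).
Local Notation ent := (ent A0 A1).
Local Notation pts := (vote_pts d t m A0 A1).
Local Notation sim := (similar t A0 A1 S0).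
Local Notation kept := (kept_vote t l n A0 A1 S0).
Local Notation masks := (counter_mask t l n A0 A1 S0).
Local Notation good := (passes d t m p l n A0 A1).
Local Notation del_score := (score_without d t m n A0 A1).

Definition del (D : {set 'I_n}) (c : nat) := \sum_(i in D) pts i c.
Definition rest (D : {set 'I_n}) (c : nat) := \sum_(i in ~: D) pts i c.
Definition full (c : nat) := \sum_(0 <= i < n) pts i c.

Definition solution (D : {set 'I_n}) : Prop :=
  #|D| <= l /\ forall c : 'I_m, c != p -> rest D c < rest D p.

Lemma full_split D c : full c = rest D c + del D c.
Proof.
rewrite /full big_mkord (bigID (mem D)) /= addnC; congr (_ + _).
by apply: eq_bigl => i; rewrite inE.
Qed.

Hypothesis len_t : forall i, i < n -> len i <= t.
Hypothesis ent_m : forall i k, i < n -> k < len i -> ent i k < m.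
Hypothesis S0_full : forall c, c < m -> S0 c = full c.

(** Where the two votes differ, both entries are below the threshold, so neither is [c]. *)
Lemma sim_pts th i j c : sim th i j -> th <= S0 c -> pts i c = pts j c.
Proof.
move=> /andP[/eqP El /allP Hs] Hc; apply: eq_big_nat => k /andP[_ Hk].
have := Hs k; rewrite mem_iota add0n => /(_ Hk); rewrite -El.
case: ltnP => //= _ /orP[/eqP->//|/andP[H1 H2]].
rewrite (_ : (ent i k == c) = false); last by apply/eqP => Eq; move: H1; rewrite Eq; lia.
by rewrite (_ : (ent j k == c) = false) //; apply/eqP => Eq; move: H2; rewrite Eq; lia.
Qed.

(* A deleted vote that is not kept has [l] earlier similar votes, one of which
   is not deleted; swapping the two preserves the score of every candidate that
   reaches the threshold, and the others stay below it anyway. *)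
Lemma exchange D : solution D ->
  exists D', [/\ solution D', rest D' p = rest D p
    & forall i, i \in D' -> kept (rest D p) i].
Proof.
(* The sum of the deleted indices drops when [i] is exchanged for an earlier [j]. *)
have [k] := ubnP (\sum_(i in D) (i : nat)); elim: k D => // k IH D Hk [Hl Hw].
set th := rest D p in Hw *.
case: (boolP [forall i in D, kept th i]) => [/forallP H|].
  by exists D; split => // i; apply/implyP.
rewrite negb_forall => /existsP[i]; rewrite negb_imply => /andP[iD].
rewrite /kept_vote -leqNgt big_mkord => Hkept.
pose J := [set j : 'I_n | (j < i) && sim th i j].
have HJ : l <= #|J|.
  apply: leq_trans Hkept _; rewrite cardsE -sum1_card [X in _ <= X]big_mkcond /=.
  by apply: leq_sum => j _; rewrite unfold_in; case: (_ && _).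
have cD : #|D| = #|D :\ i|.+1 by rewrite (cardsD1 i) iD.
(* [D] without [i] has fewer than [l] elements, so it cannot contain all of [J]. *)
have [j jJ jD] : exists2 j, j \in J & j \notin D :\ i.
  apply/subsetPn; apply/negP => /subset_leq_card/(leq_trans HJ).
  by rewrite -ltnS -cD ltnNge Hl.
move: jJ; rewrite inE => /andP[ji sij].
have jD' : j \notin D.
  move: jD; rewrite !inE negb_and negbK => /orP[/eqP Eji|//].
  by move: ji; rewrite Eji ltnn.
pose D' := j |: (D :\ i).
(* Thus [p] itself reaches the threshold, and the exchange preserves its score. *)
have th_p : th <= S0 p by rewrite S0_full // (full_split D); lia.
have Hrest c : c < m -> th <= S0 c -> rest D' c = rest D c.
  move=> cm Hc; have Ed : del D' c = del D c.
    by rewrite /del big_setU1 //= (big_setD1 i iD) /= (sim_pts sij Hc).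
  by have := full_split D c; have := full_split D' c; lia.
have Sp : rest D' p = th by rewrite Hrest.
have [||D'' [S'' R'' K'']] := IH D'.
- rewrite big_setU1 //=; move: Hk; rewrite (big_setD1 i iD) /=; lia.
- split; first by rewrite cardsU1 jD; lia.
  move=> c cp; rewrite Sp; case: (leqP th (S0 c)) => Hc.
    by rewrite Hrest //; apply: Hw.
  by apply: leq_ltn_trans Hc; rewrite S0_full // (full_split D'); lia.
by exists D''; rewrite Sp in R'' K''.
Qed.

(** A bad [c] other than [p] ends below the threshold that its full score reaches, so a deleted vote
    gives it points. It is therefore named by a deleted vote and a position: at most [l * t] pairs,
    and [p] adds 1. *)
Lemma card_bad D : solution D ->
  #|[set c : 'I_m | rest D p <= S0 c]| <= l * t + 1.
Proof.
move=> [Hl Hw].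
(* The default [p] for meaningless positions is harmless, as [p] is in the covering set anyway. *)
pose f (x : 'I_n * 'I_t) : 'I_m := insubd p (ent x.1 x.2).
have : [set c : 'I_m | rest D p <= S0 c] \subset
    p |: f @: setX D [set: 'I_t].
  apply/subsetP => c; rewrite !inE S0_full // (full_split D).
  case: eqP => //= /eqP cp Hc; have := Hw c cp => Hlt.
  have : del D c != 0 by lia.
  rewrite sum_nat_eq0 negb_forall => /existsP[i].
  rewrite negb_imply => /andP[iD]; rewrite /pts big_mkord sum_nat_eq0 negb_forall.
  move=> /existsP[k]; rewrite /= muln_eq0 negb_or eqb0 negbK => /andP[/andP[Hk /eqP Ec] _].
  apply/imsetP; exists (i, k); first by rewrite !inE iD.
  by apply: val_inj; rewrite /f val_insubd Ec ltn_ord.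
move=> /subset_leq_card H; apply: leq_trans H _.
apply: leq_trans (leq_card_setU _ _) _; rewrite cards1 addnC leq_add2r.
apply: leq_trans (leq_imset_card _ _) _.
by rewrite cardsX cardsT card_ord leq_mul2r Hl orbT.
Qed.

(** The signature of a vote records for each of [t] positions whether it is empty, good, or which
    bad candidate it holds: at most [l * t + 3] values. Equal signatures mean similar votes, and
    each signature is shared by at most [l] kept votes. *)
Lemma card_kept D : solution D ->
  #|[set i : 'I_n | kept (rest D p) i]| <= l * (l * t + 3) ^ t.
Proof.
move=> HD; set th := rest D p; set K := [set i | _].
have HB := card_bad HD; rewrite -/th in HB; set B := [set c | _] in HB.
pose R : {set option (option 'I_m)} := None |: (Some None |: [set Some (Some c) | c in B]).
pose sg (i : 'I_n) : {ffun 'I_t -> option (option 'I_m)} :=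
  [ffun k : 'I_t => if k < len i then
     Some (if th <= S0 (ent i k) then Some (insubd p (ent i k)) else None) else None].
have sgR i : sg i \in ffun_on (mem R).
  apply/ffun_onP => k; rewrite ffunE !inE; case: ltnP => //= Hk.
  have Hm := ent_m (ltn_ord i) Hk.
  case: leqP => //= Hth; apply/imsetP.
  by exists (insubd p (ent i k)); rewrite // inE val_insubd Hm.
have sg_sim i j : sg i = sg j -> sim th i j.
  move=> Eq; have Eqk (k : 'I_t) : sg i k = sg j k by rewrite Eq.
  have El : len i = len j.
    have Li := len_t (ltn_ord i); have Lj := len_t (ltn_ord j).
    case: (ltngtP (len i) (len j)) => // Hlt.
      have Hk : len i < t by lia.
      by have := Eqk (Ordinal Hk); rewrite !ffunE /= ltnn Hlt.
    have Hk : len j < t by lia.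
    by have := Eqk (Ordinal Hk); rewrite !ffunE /= ltnn Hlt.
  rewrite /similar El eqxx; apply/allP => k; rewrite mem_iota add0n => /= Hk.
  apply/implyP => Hkl; have := Eqk (Ordinal Hk); rewrite !ffunE /= El Hkl.
  case: leqP => Hi; case: leqP => Hj //=; rewrite ?orbT // => -[].
  move/(congr1 val); rewrite !val_insubd !ent_m ?El // => ->.
  by rewrite eqxx.
(* All other members of the fiber are earlier votes similar to its last one, which is kept; so there
   are fewer than [l] of them. *)
have fiber y : #|[set i in K | sg i == y]| <= l.
  case: (set_0Vmem [set i in K | sg i == y]) => [->|[i0 Hi0]]; first by rewrite cards0.
  case: (arg_maxnP (fun i : 'I_n => i : nat) Hi0) => i Hi Hmax.
  have {}Hi : i \in [set i in K | sg i == y] := Hi.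
  move: (Hi); rewrite inE => /andP[iK /eqP sgi].
  move: iK; rewrite inE /kept_vote big_mkord => iK.
  rewrite (cardsD1 i) Hi add1n; apply: leq_ltn_trans iK.
  rewrite -sum1_card big_mkcond /=; apply: leq_sum => j _.
  case: ifP => // ; rewrite !inE => /and3P[ji jK /eqP sgj].
  rewrite sg_sim ?sgi ?sgj // andbT.
  have jF : j \in [set i in K | sg i == y] by rewrite !inE jK sgj eqxx.
  have /= := Hmax j jF; rewrite leq_eqVlt => /predU1P[/val_inj Eji|->//].
  by rewrite Eji eqxx in ji.
have -> : #|K| = \sum_(y in ffun_on (mem R)) #|[set i in K | sg i == y]|.
  rewrite -sum1_card (partition_big sg (mem (ffun_on (mem R)))) //=.
  by apply: eq_bigr => y _; rewrite -sum1_card; apply: eq_bigl => i; rewrite !inE.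
apply: leq_trans (leq_sum _ (fun y _ => fiber y)) _.
rewrite sum_nat_const mulnC leq_mul2l card_ffun_on card_ord; apply/orP; right.
case: (posnP t) => [->//|t0]; rewrite leq_exp2r // /R !cardsU1.
apply: leq_trans (leq_add (leq_b1 _) (leq_add (leq_b1 _) (leq_imset_card _ _))) _.
by lia.
Qed.

Lemma good_solution (bs : seq bool) (D : {set 'I_n}) :
  (forall i : 'I_n, nth false bs i = (i \in D)) -> good bs <-> solution D.
Proof.
move=> Hb.
have Ec : \sum_(0 <= i < n) nth false bs i = #|D|.
  rewrite big_mkord -sum1_card [RHS]big_mkcond /=; apply: eq_bigr => i _.
  by rewrite Hb; case: (i \in D).
have Es c : del_score bs c = rest D c.
  rewrite /score_without /rest big_mkord [RHS]big_mkcond /=; apply: eq_bigr => i _.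
  by rewrite Hb inE; case: (i \in D) => /=; rewrite ?mul1n ?mul0n.
rewrite /passes Ec; split.
  move=> /andP[Hl /allP Hw]; split => // c cp.
  have := Hw c; rewrite mem_iota add0n ltn_ord => /(_ isT).
  by rewrite !Es val_eqE (negbTE cp).
move=> [-> Hw]; apply/allP => c; rewrite mem_iota add0n => /= cm.
by have := Hw (Ordinal cm); rewrite -val_eqE !Es /=; case: eqP => //= _; apply.
Qed.

Lemma count_mkseq_card (f : nat -> bool) :
  count id (mkseq f n) = #|[set i : 'I_n | f i]|.
Proof.
rewrite /mkseq count_map -val_enum_ord count_map cardsE cardE size_filter.
by rewrite enumT.
Qed.

(** A passing mask is a solution whatever threshold produced it. Conversely the threshold [rest D p]
    is tried because it is at most [full p], and the counter reaches the exchanged solution within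
    [E] rounds. *)
Lemma search_correct E SM : 2 ^ (l * (l * t + 3) ^ t) <= E -> full p < SM ->
  has (fun th => has (fun e => good (masks th e)) (iota 0 E)) (iota 0 SM) <->
  exists D, solution D.
Proof.
move=> HE HSM; split.
  move=> /hasP[th _ /hasP[e _ Hg]].
  exists [set i : 'I_n | nth false (masks th e) i].
  by apply/(good_solution (bs := masks th e)) => // i; rewrite inE.
move=> [D HD]; have [D' [HD' _ HK]] := exchange HD.
set th := rest D p in HK.
apply/hasP; exists th.
  rewrite mem_iota add0n; apply: leq_ltn_trans HSM.
  by rewrite (full_split D) leq_addr.
pose bs := [seq i \in D' | i <- enum 'I_n].
have Hbs (i : 'I_n) : nth false bs i = (i \in D').
  by rewrite (nth_map i) ?nth_ord_enum // size_enum_ord.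
have sbs : size bs = n by rewrite size_map size_enum_ord.
have [e He Ee] : exists2 e, e < 2 ^ count id (mkseq (kept th) n) &
    iter e (incb true (mkseq (kept th) n)) (nseq (size (mkseq (kept th) n)) false) = bs.
  apply: counter_reaches; first by rewrite size_mkseq.
  move=> i; case: (ltnP i n) => Hi; last by rewrite nth_default // sbs.
  by rewrite (Hbs (Ordinal Hi)) nth_mkseq // => /HK.
apply/hasP; exists e.
  rewrite mem_iota add0n; apply: leq_trans He _; apply: leq_trans HE.
  by rewrite leq_exp2l // count_mkseq_card; apply: card_kept.
rewrite size_mkseq in Ee; rewrite /counter_mask Ee.
by apply/(good_solution Hbs).
Qed.

End Kernel.

(** * Borda scores as natural weights *)

Definition npts (d : borda_rule) (m : nat) (v : seq 'I_m) (c : 'I_m) : nat :=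
  if c \in v then wt d m (size v) (index c v) else 0.

Lemma size_vote m (v : seq 'I_m) : uniq v -> size v <= m.
Proof. by move=> /card_uniqP <-; rewrite -[X in _ <= X]card_ord max_card. Qed.

Lemma npts_bound d m (v : seq 'I_m) c : uniq v -> npts d v c <= m + m.
Proof.
move=> /size_vote Hs; rewrite /npts; case: ifP => // _.
by case: d; rewrite /wt; lia.
Qed.

Section Points.
Import Order.TTheory GRing.Theory Num.Theory.
Local Open Scope ring_scope.

(** [b v] is what an unranked candidate receives. For [BordaAv], position [i] exceeds it by [(m - i)
    - (m - |v| - 1) / 2 = (m + |v| - 2 i + 1) / 2], hence [a = 1 / 2]; [|v| <= m] keeps the
    truncated weights exact. *)
Lemma points_affine d (m : nat) : exists (a : rat) (b : seq 'I_m -> rat), 0 < a /\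
  forall v c, uniq v -> points d v c = a * (npts d v c)%:R + b v.
Proof.
case: d.
- exists 1, (fun=> 0); split=> // v c Hu; have Hs := size_vote Hu.
  rewrite /points /npts mul1r addr0; case: ifP => // Hc.
  have Hi : (index c v < size v)%N by rewrite index_mem.
  by rewrite /wt addn1 natrB //; apply: leq_trans Hs.
- exists 1, (fun=> 0); split=> // v c Hu.
  rewrite /points /npts mul1r addr0; case: ifP => // Hc.
  have Hi : (index c v < size v)%N by rewrite index_mem.
  by rewrite /wt natrB; [rewrite -natr1; ring|exact: ltnW].
exists (1 / 2), (fun v => (m%:R - (size v)%:R - 1) / 2); split=> [|v c Hu].
  by lra.
have Hs := size_vote Hu; rewrite /points /npts; case: ifP => Hc; last first.
  by rewrite mulr0 add0r.
have Hi : (index c v < size v)%N by rewrite index_mem.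
rewrite /wt natrB; last first.
  by move: (index c v) (size v) Hi Hs => i s; lia.
by rewrite !natrD -natr1; field.
Qed.

(** The offset is common to all candidates and the factor is positive, so strict comparisons are
    preserved. *)
Lemma unique_winner_npts d m (W : seq (seq 'I_m)) p : all uniq W ->
  unique_winner d W p <->
  forall c, c != p -> (\sum_(v <- W) npts d v c < \sum_(v <- W) npts d v p)%N.
Proof.
move=> /allP HW; have [a [b [a0 Hab]]] := points_affine d m.
have Es c : score d W c = a * (\sum_(v <- W) npts d v c)%:R + \sum_(v <- W) b v.
  rewrite /score natr_sum mulr_sumr -big_split /=.
  by apply: eq_big_seq => v /HW Hv; rewrite Hab.
by split=> H c /H; rewrite !Es ltrD2r ltr_pM2l // ltr_nat.
Qed.

End Points.

Section Instance.

Variables (d : borda_rule) (t m l : nat) (p : 'I_m) (V : seq (seq 'I_m)).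
Variables (A0 A1 : nat -> nat).

Local Notation n := (size V).
Local Notation len := (len A0 A1).
Local Notation ent := (ent A0 A1).
Local Notation pts := (vote_pts d t m A0 A1).
Local Notation vote i := (nth [::] V i).

Hypothesis V_uniq : all uniq V.
Hypothesis V_size : all (fun v => size v <= t) V.
Hypothesis lenE : forall i, i < n -> len i = size (vote i).
Hypothesis entE : forall i k, i < n -> k < size (vote i) ->
  ent i k = nth 0 (map val (vote i)) k.

Lemma vote_uniq i : i < n -> uniq (vote i).
Proof. by move=> Hi; apply: (allP V_uniq); rewrite mem_nth. Qed.

Lemma vote_size i : i < n -> size (vote i) <= t.
Proof. by move=> Hi; apply: (allP V_size (vote i)); rewrite mem_nth. Qed.

(** A vote has no duplicates, so at most one position, the index of [c], contributes to the sum. *)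
Lemma pts_npts i (c : 'I_m) : i < n -> pts i c = npts d (vote i) c.
Proof.
move=> Hi; have Hu := vote_uniq Hi; have Ht := vote_size Hi.
rewrite /vote_pts /npts lenE //; set v := vote i in Hu Ht *.
have E k : ((k < size v) && (ent i k == c)) = (c \in v) && (k == index c v).
  case: ltnP => /= Hk; last first.
    case: (boolP (c \in v)) => //= Hc; apply/esym/negbTE/eqP => Ek.
    by move: Hc; rewrite -index_mem -Ek ltnNge Hk.
  rewrite entE // (nth_map c) // val_eqE.
  apply/eqP/andP => [<-|[Hc /eqP ->]]; last by rewrite nth_index.
  by rewrite mem_nth // index_uniq.
under eq_bigr => k _ do rewrite E.
case: (boolP (c \in v)) => Hc /=; last by rewrite big1.
have Hlt : index c v < t by apply: leq_trans Ht; rewrite index_mem.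
rewrite (bigD1_seq (index c v)) ?mem_index_iota ?iota_uniq //= eqxx mul1n big1 ?addn0 //.
by move=> k /negbTE->.
Qed.

Lemma len_bound i : i < n -> len i <= t.
Proof. by move=> Hi; rewrite lenE // vote_size. Qed.

Lemma ent_bound i k : i < n -> k < len i -> ent i k < m.
Proof. by move=> Hi; rewrite lenE // => Hk; rewrite entE // (nth_map p) // ltn_ord. Qed.

Lemma full_bound : full d t m n A0 A1 p < 1 + n * (m + m).
Proof.
rewrite add1n ltnS /full big_mkord.
apply: (@leq_trans (\sum_(i < n) (m + m))); last by rewrite sum_nat_const card_ord.
by apply: leq_sum => i _; rewrite pts_npts // npts_bound // vote_uniq.
Qed.

(** Equal votes may occur several times, so sub-multisets are traded for sets of indices. *)
Lemma ccdv_solution :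
  ccdv d p V l <-> exists D : {set 'I_n}, solution d t l p A0 A1 D.
Proof.
have restE (D : {set 'I_n}) (W : seq (seq 'I_m)) (c : 'I_m) :
    perm_eq W [seq vote (val i) | i <- enum (~: D)] ->
    rest d t m A0 A1 D c = \sum_(v <- W) npts d v c.
  move=> HW; rewrite (perm_big _ HW) /= big_map big_enum /=.
  by apply: eq_bigr => i _; rewrite pts_npts.
have splitV (D : {set 'I_n}) :
    perm_eq V ([seq vote (val i) | i <- enum D] ++ [seq vote (val i) | i <- enum (~: D)]).
  rewrite -map_cat -[X in perm_eq X](mkseq_nth [::]) /mkseq -val_enum_ord -map_comp.
  apply: perm_map; apply: uniq_perm; first exact: enum_uniq.
    rewrite cat_uniq !enum_uniq andbT; apply/hasPn => i.
    by rewrite !mem_enum inE.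
  by move=> i; rewrite mem_cat !mem_enum !inE orbN.
have uW (D : {set 'I_n}) : all uniq [seq vote (val i) | i <- enum D].
  by apply/allP => v /mapP[i _ ->]; apply: vote_uniq; apply: ltn_ord.
split=> [[V'' [V' [HV [Hl Hw]]]]|[D [Hl Hw]]]; last first.
  exists [seq vote (val i) | i <- enum D], [seq vote (val i) | i <- enum (~: D)].
  split=> //; split; first by rewrite size_map -cardE.
  apply/unique_winner_npts => // c cp.
  by rewrite -!(restE D) //; apply: Hw.
have HV' : perm_eq (V'' ++ V') V by rewrite perm_sym.
(* [Is] gives the positions in [V] of the votes of [V''] followed by [V']; its first [size V'']
   entries form [D]. *)
have [Is HIs E] := perm_iotaP [::] HV'.
pose I1 := take (size V'') Is; pose I2 := drop (size V'') Is.
have sIs : size V'' + size V' = size Is by rewrite -size_cat E size_map.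
have E1 : V'' = map (nth [::] V) I1.
  by rewrite /I1 map_take -E take_size_cat.
have E2 : V' = map (nth [::] V) I2.
  by rewrite /I2 map_drop -E drop_size_cat.
have Iu : uniq (I1 ++ I2) by rewrite cat_take_drop (perm_uniq HIs) iota_uniq.
have Im i : i \in I1 ++ I2 = (i < n).
  by rewrite cat_take_drop (perm_mem HIs) mem_iota add0n.
pose D := [set i : 'I_n | val i \in I1].
move: (Iu); rewrite cat_uniq => /and3P[u1 /hasPn dis u2].
have D1 : perm_eq I1 [seq val i | i <- enum D].
  apply: uniq_perm => //; first by rewrite map_inj_uniq ?enum_uniq //; exact: val_inj.
  move=> i; apply/idP/mapP => [Hi|[j]]; last by rewrite mem_enum inE => Hj ->.
  have Hn : i < n by rewrite -Im mem_cat Hi.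
  by exists (Ordinal Hn); rewrite // mem_enum inE.
have D2 : perm_eq I2 [seq val i | i <- enum (~: D)].
  apply: uniq_perm => //; first by rewrite map_inj_uniq ?enum_uniq //; exact: val_inj.
  move=> i; apply/idP/mapP => [Hi|[j]].
    have Hn : i < n by rewrite -Im mem_cat Hi orbT.
    by exists (Ordinal Hn); rewrite // mem_enum !inE; apply: dis.
  rewrite mem_enum !inE => Hj ->.
  by have := Im j; rewrite mem_cat (negbTE Hj) ltn_ord.
exists D; split.
  by rewrite cardE -(size_map val) -(perm_size D1) -(size_map (nth [::] V)) -E1.
have PW : perm_eq V' [seq vote (val i) | i <- enum (~: D)].
  by rewrite E2 (perm_trans (perm_map _ D2)) // -map_comp.
have uV' : all uniq V'.
  by apply/allP => v Hv; apply: (allP V_uniq); rewrite (perm_mem HV) mem_cat Hv orbT.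
move=> c cp; rewrite !(restE _ V') //.
by move: Hw => /(unique_winner_npts _ _ uV'); apply.
Qed.

End Instance.

(** * Initialisation and running time *)

(** A bound chosen for being computable by three doubling loops in a row. *)
Definition tower (l t : nat) : nat := 2 ^ (2 ^ (2 ^ (l + t + 4))).

Definition pow2_cmd (x y : nat) : cmd :=
  Asn x (Cst 1);; For vI y (Asn x (Add (Var x) (Var x))).

Definition tower_cmd : cmd :=
  Asn vZ (Add (Add (Var vL) (Var vT)) (Cst 4));;
  pow2_cmd vX vZ;; pow2_cmd vY vX;; pow2_cmd vE vY.

Definition load_cmd : cmd :=
  Asn vT (Get aIn (Cst 0));; Asn vM (Get aIn (Cst 1));; Asn vP (Get aIn (Cst 2));;
  Asn vL (Get aIn (Cst 3));; Asn vN (Get aIn (Cst 4)).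

Definition offset_cmd : cmd :=
  Asn vPtr (Cst 5);;
  For vI vN (Put aOff (Var vI) (Var vPtr);;
    Asn vPtr (Add (Var vPtr) (Add (Get aIn (Var vPtr)) (Cst 1)))).

(** [vS] becomes a strict upper bound for the full score of [p], since no weight exceeds [2 m]; the
    product is a repeated addition. *)
Definition range_cmd : cmd :=
  Asn vS (Cst 1);; For vI vN (Asn vS (Add (Var vS) (Add (Var vM) (Var vM)))).

Definition solve_cmd (d : borda_rule) : cmd :=
  Asn vAns (Cst 0);; score_cmd d aFull;; search_cmd d.

Definition main_cmd (d : borda_rule) : cmd :=
  load_cmd;; offset_cmd;; range_cmd;; tower_cmd;; solve_cmd d.

Lemma pow2_spec x y s : x != vI -> y != x ->
  var (ex (pow2_cmd x y) s) x = 2 ^ var s y.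
Proof.
move=> xI yx; rewrite /pow2_cmd ex_seq; set s1 := ex (Asn _ _) s.
have <- : var s1 y = var s y by rewrite ex_var // inE.
have := @for_ind (fun k s' => var s' x = 2 ^ k) vI y (Asn x (Add (Var x) (Var x))) s1.
apply => [k s' v|||k s' _ _ _ _ IH] /=.
- by rewrite (negbTE xI).
- by rewrite eqxx.
- by rewrite inE eq_sym.
by rewrite eqxx IH expnS mul2n addnn.
Qed.

Lemma tower_spec s : var (ex tower_cmd s) vE = tower (var s vL) (var s vT).
Proof.
by rewrite /tower_cmd 3!ex_seq !pow2_spec.
Qed.

Lemma correct_phase c s B : wf c -> stable c ->
  \prod_(y <- loop_vars c) (var s y).+1 <= B -> correct c s (weight c * B).
Proof.
move=> Hw Hs HB; apply: correct_leq (@correct_stable c s Hw Hs).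
by rewrite leq_mul2l HB orbT.
Qed.

Lemma correct_then c1 c2 s B : correct c1 s (weight c1 * B) ->
  correct c2 (ex c1 s) (weight c2 * B) -> correct (c1;; c2) s (weight (c1;; c2) * B).
Proof.
by move=> H1 H2; rewrite [weight _]/= mulnDl; apply: correct_seq.
Qed.

(** [vX] and [vY] are computed and then used as bounds, so the command is not stable; each doubling
    loop is timed from the state in which its bound is known. *)
Lemma tower_correct s : correct tower_cmd s
  (weight tower_cmd * tower (var s vL) (var s vT)).
Proof.
set B := tower _ _; set z := var s vL + var s vT + 4.
have H1 : z < 2 ^ z by rewrite ltn_expl.
have H2 : 2 ^ z < 2 ^ (2 ^ z) by rewrite ltn_expl.
have H3 : 2 ^ (2 ^ z) < B by rewrite /B /tower ltn_expl.
have H0 : 1 <= B by apply: leq_ltn_trans H3.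
apply: correct_then; first by apply: correct_phase; rewrite // big_nil.
set s1 := ex _ s.
have Z1 : var s1 vZ = z by [].
apply: correct_then.
  by apply: correct_phase; rewrite // big_cons big_nil muln1 Z1; lia.
have X1 : var (ex (pow2_cmd vX vZ) s1) vX = 2 ^ z by rewrite pow2_spec.
move: (ex _ s1) X1 => s2 X1.
apply: correct_then.
  by apply: correct_phase; rewrite // big_cons big_nil muln1 X1; lia.
have Y1 : var (ex (pow2_cmd vY vX) s2) vY = 2 ^ (2 ^ z) by rewrite pow2_spec // X1.
move: (ex _ s2) Y1 => s3 Y1.
by apply: correct_phase; rewrite // big_cons big_nil muln1 Y1; lia.
Qed.

Lemma tower_computable : computable2 tower.
Proof.
pose c := Asn vL (Get aIn (Cst 0));; Asn vT (Get aIn (Cst 1));; tower_cmd.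
exists (assemble c vE) => a b.
have Hc s : (forall a' j, arr s a' j = if a' == 0 then nth 0 [:: a; b] j else 0) ->
    correct c s (weight c * tower a b).
  move=> Hs; have t0 : 1 <= tower a b by rewrite /tower expn_gt0.
  apply: correct_then; first by apply: correct_phase; rewrite // big_nil.
  apply: correct_then; first by apply: correct_phase; rewrite // big_nil.
  set s2 := ex _ _; have -> : tower a b = tower (var s2 vL) (var s2 vT).
    by rewrite /s2 /= !Hs.
  exact: tower_correct.
have [s [Hs Ho]] := @assembleP c vE [:: a; b] _ isT isT Hc.
exists (1024 * size [:: a; b] + weight c * tower a b + 2).
have := Ho _ (leqnn _).
rewrite {1 3}/c !ex_seq tower_spec; set s2 := ex _ _.
by have -> : tower (var s2 vL) (var s2 vT) = tower a b by rewrite /s2 /= !Hs.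
Qed.

(** With [u = l + t + 2], [l <= 2 ^ l] and [l * t + 3 <= 2 ^ u] bound the exponent by
    [2 ^ (l + u * t)]; then [l + u * t <= u * u <= 2 ^ (u + 2)]. *)
Lemma tower_bound l t : 2 ^ (l * (l * t + 3) ^ t) <= tower l t.
Proof.
rewrite /tower leq_exp2l //.
have Hl : l <= 2 ^ l by apply: ltnW; rewrite ltn_expl.
have Hb : l * t + 3 <= 2 ^ (l + t + 2).
  have h1 : l < 2 ^ l by rewrite ltn_expl.
  have h2 : t < 2 ^ t by rewrite ltn_expl.
  rewrite !expnD -[2 ^ 2]/4; nia.
have Hbt : (l * t + 3) ^ t <= 2 ^ ((l + t + 2) * t).
  by case: (posnP t) => [->|t0]; rewrite ?muln0 // expnM leq_exp2r.
apply: leq_trans (leq_mul Hl Hbt) _; rewrite -expnD leq_exp2l //.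
have sq u : u * u <= 2 ^ (u + 2).
  elim: u => // u IH; rewrite addSn expnS.
  case: u IH => [|[|[|u]]] // IH; nia.
have := sq (l + t + 2); have -> : l + t + 2 + 2 = l + t + 4 by lia.
nia.
Qed.

(** * Parsing the encoded input *)

Definition vote_offset m (V : seq (seq 'I_m)) i : nat :=
  5 + sumn [seq (size v).+1 | v <- take i V].

Lemma drop_encode t m (p : 'I_m) l (V : seq (seq 'I_m)) i : i < size V ->
  drop (vote_offset V i) (encode t p l V) =
  size (nth [::] V i) :: map val (nth [::] V i) ++
    flatten [seq size v :: map val v | v <- drop i.+1 V].
Proof.
move=> Hi; rewrite /encode; set enc := fun v : seq 'I_m => _.
have -> : map enc V = map enc (take i V) ++ map enc (drop i V).
  by rewrite -map_cat cat_take_drop.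
rewrite flatten_cat catA drop_size_cat; last first.
  rewrite size_cat size_flatten /shape -map_comp; congr (_ + sumn _).
  by apply: eq_map => v /=; rewrite size_map.
by rewrite (drop_nth [::] Hi).
Qed.

Lemma nth_encode_len t m (p : 'I_m) l (V : seq (seq 'I_m)) i : i < size V ->
  nth 0 (encode t p l V) (vote_offset V i) = size (nth [::] V i).
Proof. by move=> Hi; rewrite -[vote_offset V i]addn0 -nth_drop drop_encode. Qed.

Lemma nth_encode_ent t m (p : 'I_m) l (V : seq (seq 'I_m)) i k :
  i < size V -> k < size (nth [::] V i) ->
  nth 0 (encode t p l V) (vote_offset V i + (k + 1)) =
  nth 0 (map val (nth [::] V i)) k.
Proof.
by move=> Hi Hk; rewrite -nth_drop drop_encode // addn1 /= nth_cat size_map Hk.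
Qed.

Lemma offset_spec t m (p : 'I_m) l (V : seq (seq 'I_m)) s :
  arr s aIn =1 nth 0 (encode t p l V) -> var s vN = size V ->
  forall i, i < size V -> arr (ex offset_cmd s) aOff i = vote_offset V i.
Proof.
move=> Hin Hn; rewrite /offset_cmd ex_seq; set s1 := ex _ s.
set body := (X in For _ _ X).
have := @for_ind (fun k s' => var s' vPtr = vote_offset V k /\
  forall i, i < k -> arr s' aOff i = vote_offset V i) vI vN body s1.
have -> : var s1 vN = size V by [].
case=> // [|k s' Hk Ek Fv Fa [IP IA]]; first by rewrite /vote_offset take0.
have EA : arr s' aIn = arr s aIn by rewrite Fa.
rewrite /= EA Hin IP Ek nth_encode_len //; split.
  by rewrite /vote_offset (take_nth [::]) // map_rcons sumn_rcons; lia.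
move=> i; rewrite ltnS leq_eqVlt => /predU1P[->|Hi]; first by rewrite eqxx.
by rewrite ifF ?IA //; lia.
Qed.

Lemma range_spec s : var (ex range_cmd s) vS = 1 + var s vN * (var s vM + var s vM).
Proof.
rewrite /range_cmd ex_seq; set s1 := ex _ s.
have := @for_ind (fun k s' => var s' vS = 1 + k * (var s vM + var s vM)) vI vN
  (Asn vS (Add (Var vS) (Add (Var vM) (Var vM)))) s1.
have -> : var s1 vN = var s vN by [].
apply => // k s' Hk Ek Fv Fa IH.
by rewrite /= IH Fv //= mulSn; lia.
Qed.

Lemma input_size_bounds t m (p : 'I_m) l (V : seq (seq 'I_m)) :
  let N := input_size (encode t p l V) in [/\ t < N, m < N, size V < N & 5 <= N].
Proof. by rewrite /input_size /encode /=; split; lia. Qed.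

(** * The whole program on an encoded instance *)

Section Main.

Variables (d : borda_rule) (t m l : nat) (p : 'I_m) (V : seq (seq 'I_m)).

Local Notation x := (encode t p l V).
Local Notation N := (input_size x).

Variable s : state.
Hypothesis s_arr : forall a j, arr s a j = if a == 0 then nth 0 x j else 0.

Let s1 := ex load_cmd s.
Let s2 := ex offset_cmd s1.
Let s3 := ex range_cmd s2.
Let s4 := ex tower_cmd s3.

Lemma loaded : [/\ var s1 vT = t, var s1 vM = m, var s1 vP = p, var s1 vL = l
  & var s1 vN = size V].
Proof. by rewrite /s1 /= !s_arr. Qed.

Lemma ready : env t m p l (size V) (1 + size V * (m + m)) (tower l t)
  (arr s4 aIn) (arr s4 aOff) s4.
Proof.
have [Et Em Ep El En] := loaded.
split => //; rewrite /s4.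
- by rewrite ex_var // /s3 ex_var // /s2 ex_var.
- by rewrite ex_var // /s3 ex_var // /s2 ex_var.
- by rewrite ex_var // /s3 ex_var // /s2 ex_var.
- by rewrite ex_var // /s3 ex_var // /s2 ex_var.
- by rewrite ex_var // /s3 ex_var // /s2 ex_var.
- by rewrite ex_var // /s3 range_spec /s2 !(ex_var (c := offset_cmd)) // Em En.
by rewrite tower_spec /s3 !(ex_var (c := range_cmd)) // /s2 !(ex_var (c := offset_cmd)) // El Et.
Qed.

Lemma arr_in : arr s4 aIn =1 nth 0 x.
Proof.
by move=> j; rewrite /s4 ex_arr // /s3 ex_arr // /s2 ex_arr // /s1 ex_arr // s_arr.
Qed.

Lemma arr_off i : i < size V -> arr s4 aOff i = vote_offset V i.
Proof.
have [_ _ _ _ En] := loaded.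
move=> Hi; rewrite /s4 ex_arr // /s3 ex_arr // /s2.
apply: (@offset_spec t m p l) => // j.
by rewrite /s1 ex_arr // s_arr.
Qed.

(** The exponent comes from the last phase, which has 14 loops: [vS] counts for [N ^ 3], [vE] for
    [N * tower l t], and each of the other twelve for [N]. The earlier phases are timed separately
    because they compute these bounds. *)
Lemma main_correct : correct (main_cmd d) s (weight (main_cmd d) * (N ^ 16 * tower l t)).
Proof.
have [Bt Bm Bn B5] := input_size_bounds t p l V; have [Et Em Ep El En] := loaded.
have He := ready.
set B := N ^ 16 * _; set E := tower l t.
have E1 : 1 <= E by rewrite /E /tower expn_gt0.
have NB : N <= B.
  rewrite /B expnS -mulnA -[X in X <= _]muln1 leq_mul2l muln_gt0 expn_gt0.
  by apply/orP; right; rewrite E1 andbT; lia.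
have EB : E <= B.
  by rewrite /B -[X in X <= _]mul1n leq_mul2r expn_gt0; apply/orP; right; lia.
apply: correct_then; first by apply: correct_phase; rewrite // big_nil; lia.
rewrite -/s1; apply: correct_then.
  by apply: correct_phase; rewrite // big_cons big_nil En muln1; lia.
rewrite -/s2; apply: correct_then.
  have E2 : var s2 vN = size V by rewrite /s2 ex_var.
  by apply: correct_phase; rewrite // big_cons big_nil E2 muln1; lia.
rewrite -/s3; apply: correct_then.
  apply: correct_leq (@tower_correct s3); rewrite leq_mul2l; apply/orP; right.
  by rewrite /s3 !(ex_var (c := range_cmd)) // /s2 !(ex_var (c := offset_cmd)) // El Et.
rewrite -/s4; apply: correct_phase; [by case: d|by case: d|].
rewrite (_ : loop_vars (solve_cmd d) =
   [:: vM; vN; vT; vS; vN; vN; vT; vE; vM; vN; vT; vN; vM; vN]) //.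
rewrite !big_cons big_nil muln1 (env_m He) (env_n He) (env_t He) (env_S He) (env_E He).
have BS : (1 + size V * (m + m)).+1 <= N ^ 3.
  have : (size V).+1 * m.+1 <= N * N by apply: leq_mul.
  by rewrite -[N ^ 3]/(N * (N * N)); nia.
have BE : E.+1 <= N * E by nia.
rewrite -/E; have -> : B = N * (N * (N * (N ^ 3 * (N * (N * (N * ((N * E) *
    (N * (N * (N * (N * (N * N)))))))))))).
  by rewrite /B -/E -[N ^ 16]/(N ^ (3 + 13)) expnD !expnS expn0; lia.
by do !apply: leq_mul.
Qed.

Hypothesis V_uniq : all uniq V.
Hypothesis V_size : all (fun v => size v <= t) V.

Lemma main_value :
  (ccdv d p V l -> var (ex (main_cmd d) s) vAns = 1) /\
  (~ ccdv d p V l -> var (ex (main_cmd d) s) vAns = 0).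
Proof.
have He := ready.
have lenE i : i < size V -> len (arr s4 aIn) (arr s4 aOff) i = size (nth [::] V i).
  by move=> Hi; rewrite /len arr_in arr_off // nth_encode_len.
have entE i k : i < size V -> k < size (nth [::] V i) ->
    ent (arr s4 aIn) (arr s4 aOff) i k = nth 0 (map val (nth [::] V i)) k.
  by move=> Hi Hk; rewrite /ent arr_in arr_off // nth_encode_ent.
have E4 : ex (main_cmd d) s = ex (solve_cmd d) s4 by [].
rewrite E4 /solve_cmd ex_seq; set s5 := ex _ s4.
have He5 : env t m p l (size V) (1 + size V * (m + m)) (tower l t)
    (arr s4 aIn) (arr s4 aOff) s5 by apply: env_ex.
rewrite ex_seq; set s6 := ex _ s5.
have He6 : env t m p l (size V) (1 + size V * (m + m)) (tower l t)
    (arr s4 aIn) (arr s4 aOff) s6 by apply: env_ex.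
have A6 : var s6 vAns = 0 by rewrite /s6 ex_var.
(* The mask is still in its initial zero state, so the first scoring yields the full scores. *)
have M5 i : arr s5 aMask i = 0.
  by rewrite /s5 ex_arr // /s4 ex_arr // /s3 ex_arr // /s2 ex_arr // /s1 ex_arr // s_arr.
have F6 c : c < m -> arr s6 aFull c =
    full d t m (size V) (arr s4 aIn) (arr s4 aOff) c.
  move=> Hc; rewrite /s6 (score_spec d _ _ He5) //; apply: eq_bigr => i _.
  by rewrite M5 mul1n.
rewrite (search_spec d He6 (ltn_ord p) A6).
have SC := search_correct
  (len_bound V_size lenE) (ent_bound p lenE entE) F6
  (tower_bound l t) (full_bound d p V_uniq V_size lenE entE).
have CS := ccdv_solution d l p V_uniq V_size lenE entE.
move: SC; case: has => -[H1 H2]; split=> // H.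
- by case: H; apply/CS; apply: H1.
by have /CS/H2 := H.
Qed.

End Main.

Theorem theorem4 : forall d : borda_rule, fpt_ccdv d.
Proof.
(* 1026 covers the relocation, [1024 * size x], and the two closing instructions. The constant [K]
   is absorbed into the exponent through [K < N ^ K], valid as [N >= 5]. *)
move=> d; set K := weight (main_cmd d) + 1026.
exists (assemble (main_cmd d) vAns), tower, (K + 16); split.
  exact: tower_computable.
move=> t m p l V Vu Vs x T.
have x0 : 0 < size x by [].
have [s [Hs Ho]] := assembleP x0 (isT : vAns < 50)
  (@main_correct d t m l p V).
have [H1 H0] := main_value d Hs Vu Vs.
have [_ _ _ B5] := input_size_bounds t p l V.
have HT : 1024 * size x + weight (main_cmd d) * (input_size x ^ 16 * tower l t) + 2 <= T.
  rewrite /T; set N := input_size x; set B := N ^ 16 * tower l t.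
  have sN : size x <= N by apply: leq_addr.
  have E1 : 1 <= tower l t by rewrite /tower expn_gt0.
  have NB : N <= B.
    rewrite /B expnS -mulnA -[X in X <= _]muln1 leq_mul2l muln_gt0 expn_gt0.
    by apply/orP; right; rewrite E1 andbT; rewrite /N; lia.
  apply: (@leq_trans (K * B)); first by rewrite /K mulnDl; rewrite -/N in B5; lia.
  rewrite expnD mulnCA [X in _ <= X]mulnA -mulnA [tower l t * _]mulnC leq_mul2r.
  apply/orP; right; apply: ltnW; apply: ltn_expl; exact: leq_trans B5.
by split=> H; have := Ho _ HT; rewrite ?(H1 H) ?(H0 H).
Qed.
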